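(* Let $A=\mathbb{C}[x,y]/(xy)$, let $n\ge 1$ be an integer, and let $A^{\otimes n}_{S_n}$ be the symmetric coinvariant algebra of $A$ at the double point $0=(0,0)$. Then there is an isomorphism of $S_n$-modules $$A^{\otimes n}_{S_n}\;\simeq\;\mathbb{C}[S_n]\;\oplus\;(n-1)\,\mathrm{Ind}^{S_n}_{S_2} L_{(1,1)},$$ where $L_{(1,1)}$ is the sign representation of $S_2$, and $(n-1)\,N$ denotes the direct sum of $n-1$ copies of $N$ (the second summand is zero if $n=1$).
   Context: Identify $A^{\otimes n}$ with $\mathbb{C}[x_1,\dots,x_n,y_1,\dots,y_n]/(x_1y_1,\dots,x_ny_n)$; the symmetric group $S_n$ acts on it by simultaneously permuting the indices of the $x_k$ and the $y_k$. Let $(A^{\otimes n})^{S_n}_{+}$ be the set of $S_n$-invariant elements $P\in A^{\otimes n}$ with $P(0,\dots,0)=0$ (vanishing when all $x_k=y_k=0$), and let $J_n$ be the ideal of $A^{\otimes n}$ generated by $(A^{\otimes n})^{S_n}_{+}$. The symmetric coinvariant algebra is $A^{\otimes n}_{S_n}=A^{\otimes n}/J_n$, with the induced $S_n$-action. $\mathbb{C}[S_n]$ is the regular representation. $S_2\subset S_n$ is the subgroup permuting two of the letters and fixing the others, and $\mathrm{Ind}^G_H L=\mathbb{C}[G]\otimes_{\mathbb{C}[H]}L$. *)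

(* Defs.v *)
From HB Require Import structures.
From mathcomp Require Import all_boot all_order all_algebra all_fingroup.
From mathcomp Require Import generic_quotient ring_quotient.
From mathcomp Require Import boolp reals complex.
From mathcomp Require Import mpoly.

Set Implicit Arguments.
Unset Strict Implicit.
Unset Printing Implicit Defensive.

Import GRing.Theory.
Local Open Scope ring_scope.
Local Open Scope quotient_scope.

Definition span_of (F : nzRingType) (V : lmodType F) (X : V -> Prop) : {pred V} :=
  [pred v | `[< exists s : seq (F * V),
      (forall u, u \in s -> X u.2) /\ v = \sum_(u <- s) u.1 *: u.2 >]].

Definition ideal_gen (R : comNzRingType) (X : R -> Prop) : {pred R} :=
  [pred v | `[< exists s : seq (R * R),
      (forall u, u \in s -> X u.2) /\ v = \sum_(u <- s) u.1 * u.2 >]].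

Section Span.
Variables (F : nzRingType) (V : lmodType F) (X : V -> Prop).

Lemma span_ofP v : reflect (exists s : seq (F * V),
    (forall u, u \in s -> X u.2) /\ v = \sum_(u <- s) u.1 *: u.2)
  (v \in span_of X).
Proof. exact: asboolP. Qed.

Lemma mem_span_of v : X v -> v \in span_of X.
Proof.
move=> Xv; apply/span_ofP; exists [:: (1, v)]; split=> [u|].
  by rewrite inE => /eqP ->.
by rewrite big_seq1 scale1r.
Qed.

Lemma span_of_submod : submod_closed (span_of X).
Proof.
split; first by apply/span_ofP; exists [::]; rewrite big_nil.
move=> a v w /span_ofP [s [sX ->]] /span_ofP [t [tX ->]]; apply/span_ofP.
exists ([seq (a * u.1, u.2) | u <- s] ++ t); split=> [u|].
  by rewrite mem_cat => /orP [/mapP [x xs ->]|/tX //]; exact: (sX x xs).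
rewrite big_cat big_map scaler_sumr; congr (_ + _).
by apply: eq_bigr => u _; rewrite scalerA.
Qed.

HB.instance Definition _ :=
  GRing.isZmodClosed.Build V (span_of X) (GRing.submod_closedB span_of_submod).
Lemma span_ofZ : GRing.scaler_closed (span_of X).
Proof.
move=> a v vX; rewrite -[_ *: _]addr0.
by apply: span_of_submod.2; rewrite ?span_of_submod.1.
Qed.
End Span.

Section Ideal.
Variables (R : comNzRingType) (X : R -> Prop).

Lemma ideal_genP v : reflect (exists s : seq (R * R),
    (forall u, u \in s -> X u.2) /\ v = \sum_(u <- s) u.1 * u.2)
  (v \in ideal_gen X).
Proof. exact: asboolP. Qed.

Lemma mem_ideal_gen v : X v -> v \in ideal_gen X.
Proof.
move=> Xv; apply/ideal_genP; exists [:: (1, v)]; split=> [u|].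
  by rewrite inE => /eqP ->.
by rewrite big_seq1 mul1r.
Qed.

Lemma ideal_gen_lin a v w :
  v \in ideal_gen X -> w \in ideal_gen X -> a * v + w \in ideal_gen X.
Proof.
move=> /ideal_genP [s [sX ->]] /ideal_genP [t [tX ->]]; apply/ideal_genP.
exists ([seq (a * u.1, u.2) | u <- s] ++ t); split=> [u|].
  by rewrite mem_cat => /orP [/mapP [x xs ->]|/tX //]; exact: (sX x xs).
rewrite big_cat big_map mulr_sumr; congr (_ + _).
by apply: eq_bigr => u _; rewrite mulrA.
Qed.

Lemma ideal_gen0 : 0 \in ideal_gen X.
Proof. by apply/ideal_genP; exists [::]; rewrite big_nil. Qed.

Lemma ideal_gen_zmod : zmod_closed (ideal_gen X).
Proof.
split=> [|v w vX wX]; first exact: ideal_gen0.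
by rewrite addrC -mulN1r ideal_gen_lin.
Qed.

HB.instance Definition _ :=
  GRing.isZmodClosed.Build R (ideal_gen X) ideal_gen_zmod.

Lemma ideal_gen_morph (f : {rmorphism R -> R}) :
  (forall v, X v -> X (f v)) ->
  forall v, v \in ideal_gen X -> f v \in ideal_gen X.
Proof.
move=> fX v /ideal_genP [s [sX ->]]; apply/ideal_genP.
exists [seq (f u.1, f u.2) | u <- s]; split=> [u /mapP [x xs ->]|].
  exact: (fX _ (sX x xs)).
by rewrite big_map rmorph_sum; apply: eq_bigr => u _; rewrite rmorphM.
Qed.
End Ideal.

Lemma ideal_genZ (F : nzRingType) (R : comAlgType F) (X : R -> Prop) :
  GRing.scaler_closed (ideal_gen X).
Proof.
move=> a v vX; rewrite -(mul1r v) scalerAl -[_ * _]addr0.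
by apply: ideal_gen_lin; rewrite ?ideal_gen0.
Qed.

Definition lquot (F : nzRingType) (V : lmodType F) (U : zmodClosed V)
  of GRing.scaler_closed U := @Quotient.quot V U.

Section QuotientModule.
Variables (F : nzRingType) (V : lmodType F) (U : zmodClosed V).
Hypothesis UZ : GRing.scaler_closed U.
Local Notation Q := (lquot UZ).

HB.instance Definition _ := EqQuotient.on Q.
HB.instance Definition _ := ZmodQuotient.on Q.

Definition lpi (v : V) : Q := \pi v.

Lemma lpiK (w : Q) : lpi (repr w) = w.
Proof. exact: reprK. Qed.

Lemma lpi_eq v w : (lpi v == lpi w) = (v - w \in U).
Proof. by rewrite Quotient.idealrBE. Qed.

Lemma lpi_zmod : zmod_morphism lpi.
Proof. exact: pi_is_zmod_morphism. Qed.

HB.instance Definition _ := GRing.isZmodMorphism.Build V Q lpi lpi_zmod.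

Lemma lpi_repr v : repr (lpi v) - v \in U.
Proof. by rewrite -lpi_eq lpiK. Qed.

Definition lquot_scale (a : F) (w : Q) : Q := lpi (a *: repr w).

Lemma lquot_scale_pi a v : lquot_scale a (lpi v) = lpi (a *: v).
Proof. by apply/eqP; rewrite lpi_eq -scalerBr UZ // lpi_repr. Qed.

Lemma lquot_scaleA a b w :
  lquot_scale a (lquot_scale b w) = lquot_scale (a * b) w.
Proof. by rewrite -[w]lpiK (lquot_scale_pi b) !lquot_scale_pi scalerA. Qed.

Lemma lquot_scale1 : left_id 1 lquot_scale.
Proof. by move=> w; rewrite -[w]lpiK lquot_scale_pi scale1r. Qed.

Lemma lquot_scaleDr : right_distributive lquot_scale +%R.
Proof.
move=> a v w; rewrite -[v]lpiK -[w]lpiK -raddfD !lquot_scale_pi.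
by rewrite scalerDr raddfD.
Qed.

Lemma lquot_scaleDl v : {morph lquot_scale^~ v : a b / a + b}.
Proof. by move=> a b /=; rewrite -[v]lpiK !lquot_scale_pi scalerDl raddfD. Qed.

HB.instance Definition _ := GRing.Zmodule_isLmodule.Build F Q
  lquot_scaleA lquot_scale1 lquot_scaleDr lquot_scaleDl.

Lemma lpi_scalable : scalable lpi.
Proof. by move=> a v; rewrite -lquot_scale_pi. Qed.

HB.instance Definition _ := GRing.isScalable.Build F V Q *:%R lpi lpi_scalable.
End QuotientModule.

(* A left F[G]-module; gact is a function on all of gT, but only its values at
   elements of G carry meaning. *)
Record gmodule (F : fieldType) (gT : finGroupType) (G : {group gT}) := GModule {
  gmod_sort :> lmodType F;
  gact : gT -> gmod_sort -> gmod_sort;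
  gact_linear : {in G, forall g, linear (gact g)};
  gact1 : forall v, gact 1%g v = v;
  gactM : {in G &, forall g h v, gact (g * h)%g v = gact g (gact h v)}
}.

Definition gmod_iso (F : fieldType) (gT : finGroupType) (G : {group gT})
    (M N : gmodule F G) : Prop :=
  exists f : {linear M -> N},
    bijective f /\ {in G, forall g v, f (gact g v) = gact g (f v)}.

Section Constructions.
Variables (F : fieldType) (gT : finGroupType) (G : {group gT}).

Lemma gactB (M : gmodule F G) g (v w : M) :
  g \in G -> gact g (v - w) = gact g v - gact g w.
Proof.
by move=> gG; rewrite addrC -scaleN1r gact_linear // scaleN1r addrC.
Qed.

Section DirectSum.
Variables (M N : gmodule F G).

Definition gsum_act (g : gT) (v : (M * N)%type) : (M * N)%type :=
  (gact g v.1, gact g v.2).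

Lemma gsum_act_linear : {in G, forall g, linear (gsum_act g)}.
Proof.
by move=> g gG a [v v'] [w w']; rewrite /gsum_act /= !gact_linear.
Qed.

Lemma gsum_act1 v : gsum_act 1%g v = v.
Proof. by case: v => v w; rewrite /gsum_act !gact1. Qed.

Lemma gsum_actM :
  {in G &, forall g h v, gsum_act (g * h)%g v = gsum_act g (gsum_act h v)}.
Proof. by move=> g h gG hG [v w]; rewrite /gsum_act !gactM. Qed.

Definition gsum : gmodule F G := GModule gsum_act_linear gsum_act1 gsum_actM.
End DirectSum.

Section Copies.
Variables (k : nat) (M : gmodule F G).

Definition gcopies_act (g : gT) (v : {ffun 'I_k -> M}) : {ffun 'I_k -> M} :=
  [ffun i => gact g (v i)].

Lemma gcopies_act_linear : {in G, forall g, linear (gcopies_act g)}.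
Proof.
by move=> g gG a v w; apply/ffunP=> i; rewrite !ffunE gact_linear.
Qed.

Lemma gcopies_act1 v : gcopies_act 1%g v = v.
Proof. by apply/ffunP=> i; rewrite ffunE gact1. Qed.

Lemma gcopies_actM :
  {in G &, forall g h v,
     gcopies_act (g * h)%g v = gcopies_act g (gcopies_act h v)}.
Proof. by move=> g h gG hG v; apply/ffunP=> i; rewrite !ffunE gactM. Qed.

Definition gcopies : gmodule F G :=
  GModule gcopies_act_linear gcopies_act1 gcopies_actM.
End Copies.

Section Quotient.
Variables (M : gmodule F G) (U : zmodClosed M).
Hypothesis UZ : GRing.scaler_closed U.
Hypothesis stableU : {in G, forall g, {in U, forall v, gact g v \in U}}.

Definition gquot_act (g : gT) (w : lquot UZ) : lquot UZ :=
  lpi UZ (gact g (repr w)).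

Lemma gquot_act_pi g v : g \in G -> gquot_act g (lpi UZ v) = lpi UZ (gact g v).
Proof.
by move=> gG; apply/eqP; rewrite lpi_eq -gactB // stableU // lpi_repr.
Qed.

Lemma gquot_act_linear : {in G, forall g, linear (gquot_act g)}.
Proof.
move=> g gG a v w; rewrite -[v]lpiK -[w]lpiK -linearP.
by rewrite !gquot_act_pi // gact_linear // linearP.
Qed.

Lemma gquot_act1 w : gquot_act 1%g w = w.
Proof. by rewrite /gquot_act gact1 lpiK. Qed.

Lemma gquot_actM :
  {in G &, forall g h w, gquot_act (g * h)%g w = gquot_act g (gquot_act h w)}.
Proof.
move=> g h gG hG w; rewrite -[w]lpiK (gquot_act_pi _ hG).
by rewrite !gquot_act_pi ?groupM // gactM.
Qed.

Definition gquot : gmodule F G :=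
  GModule gquot_act_linear gquot_act1 gquot_actM.
End Quotient.
End Constructions.

Section LeftTranslation.
Variables (F : fieldType) (gT : finGroupType) (V : lmodType F).

(* A function a : gT -> V stands for \sum_g g (x) a(g) in F[gT] (x) V; left
   multiplication by g on the first factor sends it to x |-> a(g^-1 x). *)
Definition ltrans (g : gT) (a : {ffun gT -> V}) : {ffun gT -> V} :=
  [ffun x => a (g^-1 * x)%g].

Lemma ltrans_linear : {in [set: gT]%G, forall g, linear (ltrans g)}.
Proof. by move=> g _ c a b; apply/ffunP=> x; rewrite !ffunE. Qed.

Lemma ltrans1 a : ltrans 1%g a = a.
Proof. by apply/ffunP=> x; rewrite ffunE invg1 mul1g. Qed.

Lemma ltransM :
  {in [set: gT]%G &, forall g h a, ltrans (g * h)%g a = ltrans g (ltrans h a)}.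
Proof.
by move=> g h _ _ a; apply/ffunP=> x; rewrite !ffunE invMg mulgA.
Qed.

Definition free_gmod : gmodule F [set: gT]%G :=
  GModule ltrans_linear ltrans1 ltransM.

Definition pure_tensor (g : gT) (l : V) : {ffun gT -> V} :=
  [ffun x => if x == g then l else 0].

Lemma ltrans_pure g h l : ltrans g (pure_tensor h l) = pure_tensor (g * h)%g l.
Proof.
by apply/ffunP=> x; rewrite !ffunE (can2_eq (mulKVg g) (mulKg g)).
Qed.
End LeftTranslation.

Definition regular_gmod (F : fieldType) (gT : finGroupType) :
  gmodule F [set: gT]%G := free_gmod gT F^o.

Section Induced.
Variables (F : fieldType) (gT : finGroupType) (H : {group gT}).
Variable L : gmodule F H.

Definition balanced (w : {ffun gT -> L}) : Prop :=
  exists g h (l : L), h \in H /\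
    w = pure_tensor (g * h)%g l - pure_tensor g (gact h l).

Lemma balanced_stable :
  {in [set: gT]%G, forall g,
     {in span_of balanced, forall v, ltrans g v \in span_of balanced}}.
Proof.
move=> g gT0 v /span_ofP [s [sX ->]]; apply/span_ofP.
exists [seq (u.1, ltrans g u.2) | u <- s]; split=> [u /mapP [x xs ->] /=|].
  have [k [h [l [hH ->]]]] := sX x xs.
  exists (g * k)%g, h, l; split=> //.
  rewrite -mulgA -!ltrans_pure.
  by apply: (gactB (M := free_gmod gT L)); rewrite inE.
rewrite big_map; elim: s {sX} => [|x s IHs].
  by rewrite !big_nil; apply/ffunP=> x; rewrite !ffunE.
by rewrite !big_cons (ltrans_linear gT0) IHs.
Qed.

(* F[gT] (x)_{F[H]} L: the quotient of F[gT] (x)_F L by the relations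
   gh (x) l = g (x) hl. *)
Definition induced : gmodule F [set: gT]%G :=
  gquot (M := free_gmod gT L) (@span_ofZ _ _ balanced) balanced_stable.
End Induced.

Section Sign.
Variables (F : fieldType) (n : nat) (H : {group 'S_n}).

Definition sign_act (s : 'S_n) (v : F^o) : F^o := (-1) ^+ s *: v.

Lemma sign_act_linear : {in H, forall s, linear (sign_act s)}.
Proof. by move=> s _ a v w; rewrite /sign_act scalerDr !scalerA mulrC. Qed.

Lemma sign_act1 v : sign_act 1%g v = v.
Proof. by rewrite /sign_act odd_perm1 scale1r. Qed.

Lemma sign_actM :
  {in H &, forall s t v, sign_act (s * t)%g v = sign_act s (sign_act t v)}.
Proof. by move=> s t _ _ v; rewrite /sign_act scalerA odd_permM signr_addb. Qed.

Definition sign_gmod : gmodule F H :=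
  GModule sign_act_linear sign_act1 sign_actM.
End Sign.

Section Coinvariants.
Variables (F : fieldType) (n : nat).

(* Variables of {mpoly F[n + n]}: the first n are the x_k, the last n the y_k. *)
Definition diag_fun (s : 'S_n) (k : 'I_(n + n)) : 'I_(n + n) :=
  match split k with
  | inl i => lshift n (s i)
  | inr i => rshift n (s i)
  end.

Lemma diag_fun_inj s : injective (diag_fun s).
Proof.
move=> k l; rewrite /diag_fun.
case: (splitP k) => i ki; case: (splitP l) => j lj /eqP.
- by rewrite eq_lshift => /eqP /perm_inj ij; apply: val_inj; rewrite /= ki lj ij.
- by rewrite eq_lrshift.
- by rewrite eq_rlshift.
- by rewrite eq_rshift => /eqP /perm_inj ij; apply: val_inj; rewrite /= ki lj ij.
Qed.

Definition diag_perm (s : 'S_n) : 'S_(n + n) := perm (@diag_fun_inj s).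

Lemma diag_permM : {morph diag_perm : s t / (s * t)%g}.
Proof.
move=> s t; apply/permP=> k; rewrite permM !permE /diag_fun.
case: (splitP k) => i _; first by rewrite (unsplitK (inl (s i))) permM.
by rewrite (unsplitK (inr (s i))) permM.
Qed.

Lemma diag_perm1 : diag_perm 1%g = 1%g.
Proof. by apply: (mulgI (diag_perm 1%g)); rewrite -diag_permM !mulg1. Qed.

(* s acts by x_k |-> x_(s^-1 k), y_k |-> y_(s^-1 k): products in 'S_n compose
   from left to right, so the inverse is what makes this a left action. *)
Definition poly_act (s : 'S_n) (p : {mpoly F[n + n]}) : {mpoly F[n + n]} :=
  msym (diag_perm s^-1) p.

Lemma poly_act_linear : {in [set: 'S_n]%G, forall s, linear (poly_act s)}.
Proof. by move=> s _; apply: linearP. Qed.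

Lemma poly_act1 p : poly_act 1%g p = p.
Proof. by rewrite /poly_act invg1 diag_perm1 msym1m. Qed.

Lemma poly_actM :
  {in [set: 'S_n]%G &, forall s t p,
     poly_act (s * t)%g p = poly_act s (poly_act t p)}.
Proof. by move=> s t _ _ p; rewrite /poly_act invMg diag_permM msymMm. Qed.

Definition poly_gmod : gmodule F [set: 'S_n]%G :=
  GModule poly_act_linear poly_act1 poly_actM.

Definition xy_rel (p : {mpoly F[n + n]}) : Prop :=
  exists k : 'I_n, p = 'X_(lshift n k) * 'X_(rshift n k).

Definition xy_ideal : {pred {mpoly F[n + n]}} := ideal_gen xy_rel.

Lemma xy_idealZ : GRing.scaler_closed xy_ideal.
Proof. exact: ideal_genZ. Qed.

Lemma xy_ideal_eval0 p : p \in xy_ideal -> p.@[fun=> 0] = 0.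
Proof.
move=> /ideal_genP [s [sX ->]]; rewrite raddf_sum big_seq big1 //= => u us.
by have [k ->] := sX u us; rewrite !mevalM !mevalXU !mulr0.
Qed.

Lemma xy_ideal_idealr : idealr_closed xy_ideal.
Proof.
split; [exact: ideal_gen0 | | by move=> a p q; apply: ideal_gen_lin].
by apply/negP=> /xy_ideal_eval0 /eqP; rewrite meval1 oner_eq0.
Qed.

HB.instance Definition _ :=
  isIdealr.Build {mpoly F[n + n]} xy_ideal xy_ideal_idealr.

Lemma xy_ideal_stable :
  {in [set: 'S_n]%G, forall s, {in xy_ideal, forall p, poly_act s p \in xy_ideal}}.
Proof.
move=> s _; apply: ideal_gen_morph => _ [k ->].
exists (s^-1 k)%g; rewrite rmorphM /= /msym !mmapX !mmap1U ![diag_perm _ _]permE.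
by rewrite /diag_fun (unsplitK (inl k)) (unsplitK (inr k)).
Qed.

(* F[x_1..x_n, y_1..y_n]/(x_1 y_1, .., x_n y_n), i.e. the n-th tensor power of
   F[x,y]/(xy). *)
Definition tensA := {ideal_quot xy_ideal}.

HB.instance Definition _ := EqQuotient.on tensA.
HB.instance Definition _ := GRing.ComNzRing.on tensA.
HB.instance Definition _ := GRing.Lmodule.copy tensA (lquot xy_idealZ).

Definition tpi : {mpoly F[n + n]} -> tensA := lpi xy_idealZ.

Lemma tpiK (P : tensA) : tpi (repr P) = P.
Proof. exact: reprK. Qed.

Lemma tpi_eq p q : (tpi p == tpi q) = (p - q \in xy_ideal).
Proof. exact: lpi_eq. Qed.

Lemma tpi_linear : linear tpi.
Proof. exact: (linearP (lpi xy_idealZ)). Qed.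

Lemma tpi_monoid : monoid_morphism tpi.
Proof.
split; rewrite /tpi /lpi; first exact: (rmorph1 \pi_({ideal_quot xy_ideal})).
exact: (rmorphM \pi_({ideal_quot xy_ideal})).
Qed.

HB.instance Definition _ :=
  GRing.isLinear.Build F {mpoly F[n + n]} tensA *:%R tpi tpi_linear.
HB.instance Definition _ :=
  GRing.isMonoidMorphism.Build {mpoly F[n + n]} tensA tpi tpi_monoid.

Lemma tensA_scaleAl (a : F) (P Q : tensA) : a *: (P * Q) = a *: P * Q.
Proof.
by rewrite -[P]tpiK -[Q]tpiK -linearZ -!rmorphM -linearZ scalerAl.
Qed.

HB.instance Definition _ :=
  GRing.Lmodule_isLalgebra.Build F tensA tensA_scaleAl.
HB.instance Definition _ := GRing.Lalgebra_isComAlgebra.Build F tensA.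

Definition tensA_act (s : 'S_n) (P : tensA) : tensA := tpi (poly_act s (repr P)).

Lemma tensA_act_pi s p : tensA_act s (tpi p) = tpi (poly_act s p).
Proof.
exact: (gquot_act_pi (M := poly_gmod) xy_idealZ xy_ideal_stable p (in_setT s)).
Qed.

Lemma tensA_act_linear : {in [set: 'S_n]%G, forall s, linear (tensA_act s)}.
Proof.
move=> s sS a P Q; rewrite -[P]tpiK -[Q]tpiK -linearP !tensA_act_pi.
by rewrite (poly_act_linear sS) linearP.
Qed.

Lemma tensA_act1 P : tensA_act 1%g P = P.
Proof. by rewrite /tensA_act poly_act1 tpiK. Qed.

Lemma tensA_actM :
  {in [set: 'S_n]%G &, forall s t P,
     tensA_act (s * t)%g P = tensA_act s (tensA_act t P)}.
Proof.
move=> s t sS tS P; rewrite -[P]tpiK (tensA_act_pi t) !tensA_act_pi.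
by rewrite poly_actM.
Qed.

Definition tensA_gmod : gmodule F [set: 'S_n]%G :=
  GModule tensA_act_linear tensA_act1 tensA_actM.

Lemma tensA_act_monoid s : monoid_morphism (tensA_act s).
Proof.
split=> [|P Q]; first by rewrite -(rmorph1 tpi) tensA_act_pi /poly_act msym1.
rewrite -[P]tpiK -[Q]tpiK -rmorphM !tensA_act_pi -rmorphM.
by rewrite /poly_act msymM.
Qed.

HB.instance Definition _ s := GRing.isLinear.Build F tensA tensA *:%R
  (tensA_act s) (tensA_act_linear (in_setT s)).
HB.instance Definition _ s := GRing.isMonoidMorphism.Build tensA tensA
  (tensA_act s) (tensA_act_monoid s).

(* The value P(0,...,0), which does not depend on the representative. *)
Definition tensA_eval0 (P : tensA) : F := (repr P).@[fun=> 0].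

Lemma tensA_eval0_pi p : tensA_eval0 (tpi p) = p.@[fun=> 0].
Proof.
apply/eqP; rewrite -subr_eq0 -mevalB; apply/eqP/xy_ideal_eval0.
exact: lpi_repr.
Qed.

Definition pos_invariant (P : tensA) : Prop :=
  (forall s : 'S_n, tensA_act s P = P) /\ tensA_eval0 P = 0.

Definition coinv_ideal : {pred tensA} := ideal_gen pos_invariant.

HB.instance Definition _ :=
  GRing.isZmodClosed.Build tensA coinv_ideal (ideal_gen_zmod pos_invariant).

Lemma coinv_idealZ : GRing.scaler_closed coinv_ideal.
Proof. exact: ideal_genZ. Qed.

Lemma coinv_ideal_stable :
  {in [set: 'S_n]%G, forall s,
     {in coinv_ideal, forall P, tensA_act s P \in coinv_ideal}}.
Proof.
move=> s _; apply: (ideal_gen_morph (f := tensA_act s)) => P [Pinv P0].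
by change (pos_invariant (tensA_act s P)); rewrite Pinv; split.
Qed.

Definition coinvariants : gmodule F [set: 'S_n]%G :=
  gquot (M := tensA_gmod) coinv_idealZ coinv_ideal_stable.
End Coinvariants.

(* Main.v *)
(* The algebra has a basis of monomials z^e, e in Z^n, where z_k^(e_k) is x_k^(e_k)
   or y_k^(-e_k) according to the sign of e_k.  Modulo the ideal I generated by
   the elementary symmetric functions e_d(x), e_d(y) (d >= 1), and modulo monomials
   with a smaller sum of squares of exponents, the rearrangements of two
   consecutive values v - 1, v of e sum to zero.  Hence the quotient is spanned by
   the translates of monomials attached to a set T of breaks of {1,...,n} and to a
   cut of T into a set of x-breaks followed by a set of y-breaks; the piece
   attached to T is a quotient of the ribbon representation of T, whatever the
   cut.  Applied to symmetrized polynomials the same relation shows that I is the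
   whole coinvariant ideal.

   In the group algebra there are orthogonal idempotents eps_T with sum 1 such
   that the functions invariant under the Young subgroup of T are the sum of the
   ideals of the eps_T' for T' in T.  They turn the pieces with empty y-part into
   C[S_n], and those whose first y-break is t into the module induced from the
   sign of the transposition (t t+1), so that C[S_n] + (n-1) Ind L maps onto the
   quotient.

   This surjection is injective because the n!(n+1)/2 descent monomials are
   independent modulo I.  Consider (n+1)! points, a of the x_k and the remaining
   n - a of the y_k being the negatives of nontrivial roots of unity, at which
   e_d(x) + e_(n+1-d)(y) = 1 for every d.  By induction on a weight for which e_d(x)
   dominates e_(n+1-d)(y), every function on these points is a combination of the
   descent monomials and of n!(n+1)/2 products of an e_j(y) with a monomial.  As
   the (n+1)! spanning functions are then a basis, and I is homogeneous, no descent
   monomial is redundant modulo I. *)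

Require Import Defs.
From HB Require Import structures.
From mathcomp Require Import all_boot all_order all_algebra all_fingroup.
From mathcomp Require Import generic_quotient ring_quotient.
From mathcomp Require Import boolp reals complex.
From mathcomp Require Import mpoly separable.
From mathcomp Require Import zify ring.

Set Implicit Arguments.
Unset Strict Implicit.
Unset Printing Implicit Defensive.

Import Defs.
Import Order.TTheory GRing.Theory Num.Theory.
Local Open Scope ring_scope.

(** * Subspaces given by predicates *)

Section Subspace.
Variables (F : fieldType) (V : lmodType F).

Definition subspace (W : V -> Prop) :=
  W 0 /\ forall a p q, W p -> W q -> W (a *: p + q).

Variable W : V -> Prop.
Hypothesis WS : subspace W.

Lemma subspace0 : W 0. Proof. exact: WS.1. Qed.

Lemma subspaceD p q : W p -> W q -> W (p + q).
Proof. by rewrite -{2}[p]scale1r; apply: WS.2. Qed.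

Lemma subspaceZ a p : W p -> W (a *: p).
Proof. by move=> Wp; rewrite -[_ *: _]addr0; apply: WS.2 => //; apply: subspace0. Qed.

Lemma subspaceN p : W p -> W (- p).
Proof. by rewrite -scaleN1r; apply: subspaceZ. Qed.

Lemma subspaceB p q : W p -> W q -> W (p - q).
Proof. by move=> Wp Wq; apply: subspaceD => //; apply: subspaceN. Qed.

Lemma subspace_sum I (r : seq I) (P : pred I) (f : I -> V) :
  (forall i, P i -> W (f i)) -> W (\sum_(i <- r | P i) f i).
Proof. by move=> Wf; apply: big_ind; [exact: subspace0|exact: subspaceD|]. Qed.

Lemma subspace_scaleK a p : a != 0 -> W (a *: p) -> W p.
Proof. by move=> a0 /(subspaceZ a^-1); rewrite scalerA mulVf // scale1r. Qed.

Lemma subspace_addK p q : W q -> W (p + q) -> W p.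
Proof. by move=> Wq Wpq; rewrite -(addrK q p); apply: subspaceB. Qed.
End Subspace.

(** * Descents and Young subgroups *)

Section Descents.
Variable m : nat.
Implicit Types (w k : 'S_m.+1) (T : {set 'I_m}) (t : 'I_m).

Definition lo t : 'I_m.+1 := widen_ord (leqnSn m) t.
Definition hi t : 'I_m.+1 := lift ord0 t.

Lemma val_lo t : lo t = t :> nat. Proof. by []. Qed.
Lemma val_hi t : hi t = t.+1 :> nat. Proof. by []. Qed.

(* A set T of breaks, t standing for the break between t and t+1. *)
Definition young T : {set 'S_m.+1} :=
  [set k : 'S_m.+1 | [forall t in T, forall i : 'I_m.+1, (k i <= t)%N == (i <= t)%N]].

Lemma youngP T k :
  reflect (forall t, t \in T -> forall i, (k i <= t)%N = (i <= t)%N) (k \in young T).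
Proof.
rewrite inE; apply: (iffP forall_inP) => [H t tT i|H t tT].
  exact: (eqP (forallP (H t tT) i)).
by apply/forallP => i; rewrite H.
Qed.

Lemma young_group_set T : group_set (young T).
Proof.
apply/group_setP; split=> [|k l /youngP kT /youngP lT].
  by apply/youngP=> t tT i; rewrite perm1.
by apply/youngP=> t tT i; rewrite permM lT // kT.
Qed.
Canonical young_group T := Group (young_group_set T).

Lemma youngS T T' : T \subset T' -> young T' \subset young T.
Proof.
by move=> /subsetP sT; apply/subsetP=> k /youngP kT; apply/youngP=> t /sT; apply: kT.
Qed.

Definition adj t : 'S_m.+1 := tperm (lo t) (hi t).

Lemma adjE t i : adj t i = if i == lo t then hi t else if i == hi t then lo t else i.
Proof. by rewrite /adj; case: tpermP => [->|->|/eqP/negPf-> /eqP/negPf->]; rewrite ?eqxx //; case: eqP => // /(congr1 val) /=; rewrite /bump; lia. Qed.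

Lemma lo_neq_hi t : lo t != hi t.
Proof. by apply/eqP=> /(congr1 val); rewrite /= /bump; lia. Qed.

Lemma adj_young T t : t \notin T -> adj t \in young T.
Proof.
move=> tT; apply/youngP=> s sT i.
have st : s <> t :> nat by move=> /val_inj st; rewrite -st sT in tT.
rewrite adjE; case: eqP => [->|_]; first by rewrite val_hi val_lo; lia.
by case: eqP => [->|//]; rewrite val_hi val_lo; lia.
Qed.

(** These are the descents of the word w^-1(0), ..., w^-1(m). Products in ['S_n] compose from left
    to right, so right multiplication permutes the positions of this word, and a coset w [young T]
    rearranges it inside the blocks of T. *)
Definition Des w : {set 'I_m} := [set t | (w^-1%g (hi t) < w^-1%g (lo t))%N].

(** A rearrangement statistic: on a coset of [young T] it is largest where the word of w^-1
    increases inside every block. *)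
Definition rho w : nat := \sum_(i < m.+1) i * (w^-1)%g i.

Lemma rho_adj w t : t \in Des w -> (rho w < rho (w * adj t)%g)%N.
Proof.
rewrite inE /rho => tw.
have E x : ((w * adj t)^-1)%g x = (w^-1)%g (adj t x).
  by rewrite invMg permM; congr (fun_of_perm _ _); rewrite /adj tpermV.
under [X in (_ < X)%N]eq_bigr => i _ do rewrite E.
have S (f : 'I_m.+1 -> nat) : (\sum_(i < m.+1) i * f i = lo t * f (lo t) +
    (hi t * f (hi t) + \sum_(i < m.+1 | (i != lo t) && (i != hi t)) i * f i))%N.
  by rewrite (bigD1 (lo t)) //= (bigD1 (hi t)) //= eq_sym lo_neq_hi.
rewrite !S.
rewrite [X in (_ + (_ + X) < _)%N](_ : _ = \sum_(i < m.+1 | (i != lo t) && (i != hi t)) i * (w^-1)%g (adj t i))%N; last first.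
  apply: eq_bigr => i /andP[i1 i2].
  by rewrite adjE (negPf i1) (negPf i2).
rewrite !adjE !eqxx eq_sym (negPf (lo_neq_hi t)).
move: tw (val_lo t) (val_hi t); set A := (\sum_(i < m.+1 | _) _)%N.
move: (w^-1%g (hi t) : nat) (w^-1%g (lo t) : nat) (lo t : nat) (hi t : nat) A (t : nat).
by move=> a b c d A e ab -> ->; nia.
Qed.

Lemma incr_interval w (i j : 'I_m.+1) :
  (forall t, (i <= t < j)%N -> t \notin Des w) -> (i < j)%N ->
  ((w^-1)%g i < (w^-1)%g j)%N.
Proof.
case: j => j jm /=; elim: j jm => // j IH jm H ij.
have jm' : (j < m)%N by [].
pose t := Ordinal jm'.
have tD : t \notin Des w by apply: H => /=; lia.
move: tD; rewrite inE -leqNgt.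
have -> : hi t = Ordinal jm by apply: val_inj.
have -> : lo t = Ordinal (ltnW jm) by apply: val_inj.
move=> le1.
have lt1 : ((w^-1)%g (Ordinal (ltnW jm)) < (w^-1)%g (Ordinal jm))%N.
  rewrite ltn_neqAle le1 andbT; apply/eqP=> /val_inj /perm_inj /(congr1 val) /=; lia.
have [E|ne] := eqVneq (i : nat) j.
  suff -> : i = Ordinal (ltnW jm) by [].
  by apply: val_inj.
apply: leq_ltn_trans lt1; apply/ltnW/IH; last by lia.
by move=> s sl; apply: H; lia.
Qed.

(** A block has only one increasing arrangement. At the least x moved by k, both k x and k^-1 x lie
    to the right of x in its block, and the two words order w^-1(x) and w^-1(k^-1 x) in opposite
    ways. *)
Lemma young_no_descent T w k : k \in young T ->
  Des w \subset T -> Des (w * k)%g \subset T -> k = 1%g.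
Proof.
move=> /youngP kT /subsetP D1 /subsetP D2.
have kVT t : t \in T -> forall i, ((k^-1)%g i <= t)%N = (i <= t)%N.
  by move=> tT i; rewrite -(kT t tT) permKV.
apply/invg_inj; rewrite invg1; apply/permP => i; rewrite perm1.
case: i => i; elim/ltn_ind: i => i IH im.
set x := Ordinal im; apply/eqP/negP => /negP ne.
have fixlt (j : 'I_m.+1) : (j < i)%N -> (k^-1)%g j = j.
  by case: j => j jm /= ji; apply: IH.
have gt1 : (i < (k^-1)%g x)%N.
  rewrite ltnNge; apply/negP=> le1.
  have lt1 : ((k^-1)%g x < i)%N.
    by rewrite ltn_neqAle le1 andbT; apply: contra ne => /eqP E; apply/eqP/val_inj.
  by have /perm_inj E := fixlt _ lt1; rewrite E eqxx in ne.
pose j := k x.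
have kj : (k^-1)%g j = x by rewrite permK.
have ij : (i < j)%N.
  rewrite ltnNge; apply/negP=> le1.
  have [E|ne1] := eqVneq (j : nat) i.
    by have E' : j = x by [apply: val_inj]; rewrite E' in kj; rewrite kj eqxx in ne.
  have lt1 : (j < i)%N by rewrite ltn_neqAle ne1.
  by have := fixlt _ lt1; rewrite kj => /(congr1 val) /=; lia.
have noT t : (i <= t < j)%N -> t \notin T.
  by move=> /andP[it tj]; apply/negP=> /kVT /(_ j); rewrite kj /= it leqNgt tj.
have A : (((w * k)^-1)%g x < ((w * k)^-1)%g j)%N.
  apply: incr_interval => // t tij; apply/negP=> /D2 tT.
  by move: (noT t tij); rewrite tT.
have B : ((w^-1)%g x < (w^-1)%g ((k^-1)%g x))%N.
  apply: incr_interval => // t /andP[it tk]; apply/negP=> /D1 tT.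
  have /noT : (i <= t < j)%N.
    rewrite it /=; rewrite ltnNge; apply/negP=> jt.
    have : ((k^-1)%g x <= t)%N by rewrite kVT.
    by rewrite leqNgt tk.
  by rewrite tT.
by move: A; rewrite invMg !permM kj => A; have := ltn_trans A B; rewrite ltnn.
Qed.

Lemma max_coset T w : exists2 k, k \in young T &
  forall l, l \in young T -> (rho (w * l)%g <= rho (w * k)%g)%N.
Proof.
have := @arg_maxnP _ 1%g (fun k => k \in young T) (fun k => rho (w * k)%g) (group1 _).
by case=> k kT kmax; exists k.
Qed.

Lemma max_coset_Des T w :
  (forall l, l \in young T -> (rho (w * l)%g <= rho w)%N) -> Des w \subset T.
Proof.
move=> wmax; apply/subsetP=> t tw; apply: contraT => /adj_young /wmax.
by rewrite leqNgt rho_adj.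
Qed.

(** The maximal element of w [young T] has its descents in T, hence is w by [young_no_descent]; a
    tie at w * k would put the descents of w * k in T as well. *)
Lemma rho_lt T w k : k \in young T -> Des w \subset T -> k != 1%g ->
  (rho (w * k)%g < rho w)%N.
Proof.
move=> kT wT k1; have [l lT lmax] := max_coset T w.
have lD : Des (w * l)%g \subset T.
  apply: max_coset_Des => h hT; rewrite -mulgA; apply: lmax; exact: groupM.
have l1 := young_no_descent lT wT lD; rewrite l1 mulg1 in lmax.
rewrite ltnNge; apply/negP => le1.
case/eqP: k1; apply: (young_no_descent kT wT); apply: max_coset_Des => h hT.
by apply: leq_trans le1; rewrite -mulgA; apply: lmax; apply: groupM.
Qed.

(* Straightening: the relation for a missing descent expresses phi(w) through
   coset representatives of smaller rho. *)
Lemma descent_straightening (F : numFieldType) (V : lmodType F) (W : V -> Prop)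
    (phi : 'S_m.+1 -> V) T :
  subspace W ->
  (forall w k, k \in young T -> phi (w * k)%g = phi w) ->
  (forall w t, t \in T -> W (\sum_(k in young (T :\ t)) phi (w * k)%g)) ->
  (forall w, Des w = T -> W (phi w)) ->
  forall w, W (phi w).
Proof.
move=> WS phiT rel base.
suff H : forall r w, (rho w < r)%N -> Des w \subset T -> W (phi w).
  move=> w; have [k kT kmax] := max_coset T w.
  rewrite -(phiT w k kT); apply: (H (rho (w * k)%g).+1) => //.
  by apply: max_coset_Des => l lT; rewrite -mulgA kmax // groupM.
elim=> // r IH w rw wT.
have [E|/eqP ne] := eqVneq (Des w) T; first exact: base.
have /subsetPn [t tT tw] : ~~ (T \subset Des w).
  by apply/negP=> Tw; apply: ne; apply/eqP; rewrite eqEsubset wT Tw.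
have wTt : Des w \subset T :\ t.
  by apply/subsetP=> s sw; rewrite !inE (subsetP wT) // andbT; apply: contraNneq tw => <-.
have sTt : young T \subset young (T :\ t) by apply: youngS; apply: subsetDl.
(* Here t is in T but is not a descent of w. The terms with k in [young T] all equal phi(w), and
   their number is invertible. *)
have := rel w t tT.
rewrite (bigID (fun k => k \in young T)) /=.
have -> : \sum_(k in young (T :\ t) | k \in young T) phi (w * k)%g = #|young T|%:R *: phi w.
  rewrite (eq_bigr (fun=> phi w)); last by move=> k /andP[_]; apply: phiT.
  rewrite (eq_bigl (fun k => k \in young T)); last first.
    by move=> k; rewrite /= andbC; case: (boolP (k \in young T)) => // /(subsetP sTt).
  by rewrite sumr_const scaler_nat.
move=> H.
have nz : #|young T|%:R != 0 :> F by rewrite pnatr_eq0 -lt0n cardG_gt0.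
apply: (subspace_scaleK WS nz); apply: (subspace_addK WS _ H); apply: (subspace_sum WS) => // k /andP[kT knT].
(* Each remaining term is moved to the maximal representative of its coset. As w has no descent
   outside T :\ t and k * l is not 1, [rho_lt] for T :\ t lowers [rho]. *)
have [l lT lmax] := max_coset T (w * k)%g.
rewrite -(phiT (w * k)%g l lT); apply: IH; last first.
  by apply: max_coset_Des => h hT; rewrite -mulgA lmax // groupM.
suff : (rho (w * k * l)%g < rho w)%N by lia.
rewrite -mulgA; apply: (rho_lt (T := T :\ t)) => //.
  by apply: groupM => //; apply: (subsetP sTt).
apply: contraNneq knT => kl.
by rewrite -(groupMr k lT) kl group1.
Qed.

(** One of k and k * [adj t] has no descent at t, and is 1 by [young_no_descent]. *)
Lemma young_one_break t : young (~: [set t]) = [set 1%g; adj t].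
Proof.
have tn : t \notin ~: [set t] by rewrite !inE eqxx.
apply/setP=> k; rewrite in_set2; apply/idP/idP; last first.
  by move=> /orP[] /eqP->; [exact: group1|exact: adj_young].
move=> kT; have sub w : t \notin Des w -> Des w \subset ~: [set t].
  by move=> tw; apply/subsetP=> s sw; rewrite !inE; apply: contraNneq tw => <-.
have D1 : Des 1 \subset ~: [set t].
  by apply: sub; rewrite inE invg1 !perm1 val_lo val_hi; lia.
have [tk|tk] := boolP (t \in Des k); last first.
  by rewrite (young_no_descent kT D1) ?eqxx // mul1g sub.
suff /eqP : (k * adj t = 1)%g.
  by move/eqP/(canRL (mulgK _)); rewrite mul1g /adj tpermV => ->; rewrite eqxx orbT.
apply: (young_no_descent _ D1); first by rewrite groupM ?adj_young.
rewrite mul1g sub //.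
move: tk; rewrite !inE invMg !permM /adj tpermV tpermL tpermR.
by move/ltnW; rewrite leqNgt.
Qed.

Lemma sum_Des : (\sum_(T : {set 'I_m}) #|[set w | Des w == T]| = #|{: 'S_m.+1}|)%N.
Proof.
rewrite -sum1_card (partition_big Des predT) //=.
apply: eq_bigr => T _; rewrite -sum1_card; apply: eq_bigl => w.
by rewrite inE.
Qed.

End Descents.

(** * The group algebra *)

Section GroupAlgebra.
Variables (F : fieldType) (gT : finGroupType).
Implicit Type M : gmodule F [set: gT]%G.

Lemma gactD M g (v w : M) : gact g (v + w) = gact g v + gact g w.
Proof. by rewrite -{1}[v]scale1r gact_linear ?inE // scale1r. Qed.

Lemma gact0 M g : gact g (0 : M) = 0.
Proof. by apply: (addrI (gact g 0)); rewrite -gactD !addr0. Qed.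

Lemma gactZ M g a (v : M) : gact g (a *: v) = a *: gact g v.
Proof. by rewrite -[a *: v]addr0 gact_linear ?inE // gact0 addr0. Qed.

Lemma gact_sum M g I (r : seq I) (P : pred I) (f : I -> M) :
  gact g (\sum_(i <- r | P i) f i) = \sum_(i <- r | P i) gact g (f i).
Proof. by apply: (big_morph (gact g)); [exact: gactD|exact: gact0]. Qed.

Lemma gact_mulg M g h (v : M) : gact (g * h)%g v = gact g (gact h v).
Proof. by rewrite gactM ?inE. Qed.

(* f stands for the element \sum_w f(w) w of the group algebra. *)
Definition conv M (f : {ffun gT -> F^o}) (v : M) : M := \sum_w (f w : F) *: gact w v.

Lemma conv_linearl M (v : M) : linear (fun f => conv f v).
Proof.
move=> a f g; rewrite /conv scaler_sumr -big_split; apply: eq_bigr => w _.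
by rewrite !ffunE scalerDl scalerA.
Qed.

Lemma conv_linearr M f : linear (@conv M f).
Proof.
move=> a v w; rewrite /conv scaler_sumr -big_split; apply: eq_bigr => x _ /=.
by rewrite gact_linear ?inE // scalerDr !scalerA mulrC.
Qed.

Lemma conv_suml M (v : M) I (r : seq I) (P : pred I) f :
  conv (\sum_(i <- r | P i) f i) v = \sum_(i <- r | P i) conv (f i) v.
Proof.
apply: (big_morph (fun f => conv f v)) => [f1 f2|].
  by rewrite -{1}[f1]scale1r conv_linearl scale1r.
by rewrite /conv big1 // => w _; rewrite ffunE scale0r.
Qed.

Lemma conv_sumr M f I (r : seq I) (P : pred I) (v : I -> M) :
  conv f (\sum_(i <- r | P i) v i) = \sum_(i <- r | P i) conv f (v i).
Proof.
apply: (big_morph (@conv M f)) => [v1 v2|].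
  by rewrite -{1}[v1]scale1r conv_linearr scale1r.
by rewrite /conv big1 // => w _; rewrite gact0 scaler0.
Qed.

Lemma conv0l M (v : M) : conv 0 v = 0.
Proof. by rewrite /conv big1 // => w _; rewrite ffunE scale0r. Qed.

Lemma convZl M a f (v : M) : conv (a *: f) v = a *: conv f v.
Proof. by rewrite -[a *: f]addr0 conv_linearl conv0l addr0. Qed.

Lemma convBl M f g (v : M) : conv (f - g) v = conv f v - conv g v.
Proof. by rewrite -[- g]scaleN1r addrC conv_linearl scaleN1r addrC. Qed.

Lemma conv_pure M g (v : M) : conv (pure_tensor g (1 : F^o)) v = gact g v.
Proof.
rewrite /conv (bigD1 g) //= ffunE eqxx scale1r big1 ?addr0 // => w /negPf wg.
by rewrite ffunE wg scale0r.
Qed.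

Lemma conv_ltrans M g f (v : M) : conv (ltrans g f) v = gact g (conv f v).
Proof.
rewrite /conv gact_sum (reindex_inj (mulgI g)) /=; apply: eq_bigr => w _.
by rewrite ffunE mulKg gact_mulg gactZ.
Qed.

(** For g in the regular module [conv f g] is the product of the group algebra, so this is
    associativity of the action. *)
Lemma convA M (f g : {ffun gT -> F^o}) (v : M) :
  conv (conv f (g : free_gmod gT F^o)) v = conv f (conv g v).
Proof.
rewrite {1}/conv.
transitivity (\sum_w (f w : F) *: conv (ltrans w g) v).
  rewrite /conv; under [RHS]eq_bigr => w _ do rewrite scaler_sumr.
  rewrite [RHS]exchange_big; apply: eq_bigr => x _ /=.
  rewrite sum_ffunE scaler_suml; apply: eq_bigr => w _.
  by rewrite scalerA !ffunE.
by apply: eq_bigr => w _; rewrite conv_ltrans.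
Qed.

Lemma conv_indicator M (K : {set gT}) (v : M) :
  conv [ffun w => (w \in K)%:R : F^o] v = \sum_(w in K) gact w v.
Proof.
rewrite /conv [RHS]big_mkcond; apply: eq_bigr => w _; rewrite ffunE.
by case: ifP; rewrite ?scale1r ?scale0r.
Qed.

Lemma conv_convE f (g : free_gmod gT F^o) x :
  conv f g x = \sum_w (f w : F) * (g (w^-1 * x)%g : F).
Proof. by rewrite sum_ffunE; apply: eq_bigr => w _; rewrite !ffunE. Qed.

Lemma conv_right_inv (K : {group gT}) (f : {ffun gT -> F^o}) :
  (forall w k, k \in K -> f (w * k)%g = f w) ->
  conv f ([ffun w => (w \in K)%:R] : free_gmod gT F^o) = #|K|%:R *: f.
Proof.
move=> fK; apply/ffunP=> w; rewrite conv_convE.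
transitivity (\sum_(k in K) (f w : F)); last by rewrite sumr_const ffunE scaler_nat.
rewrite (reindex_inj (mulgI w)) /= [RHS]big_mkcond.
apply: eq_bigr => k _; rewrite ffunE invMg mulgKV groupV.
by case: ifP => kK; rewrite ?mulr0 // mulr1 fK.
Qed.
End GroupAlgebra.

Section Vspace.
Variables (F : fieldType) (V : vectType F).

(** A vector space of maximal dimension inside W exhausts W, since any further vector of W could be
    added to it. *)
Lemma subspace_vspace (W : V -> Prop) : subspace W ->
  exists U : {vspace V}, forall v, v \in U <-> W v.
Proof.
move=> WS.
pose P d := `[< exists2 U : {vspace V}, \dim U = d & forall v, v \in U -> W v >].
have P0 : exists d, P d.
  exists 0; apply/asboolP; exists 0%VS; first exact: dimv0.
  by move=> v; rewrite memv0 => /eqP->; apply: subspace0.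
have Pb d : P d -> (d <= dim V)%N.
  by move=> /asboolP[U <- _]; rewrite -dimvf dimvS ?subvf.
case: (ex_maxnP P0 Pb) => d /asboolP[U dU UW] dmax.
exists U => v; split=> [/UW //|Wv]; apply: contraT => vU.
have : P (\dim (U + <[v]>)).
  apply/asboolP; exists (U + <[v]>)%VS => // w /memv_addP[u uU [x /vlineP[k ->] ->]].
  by apply: subspaceD => //; [exact: UW|exact: subspaceZ].
move/dmax; rewrite -dU leqNgt => /negP[].
rewrite ltnNge; apply: contra vU => le.
have : (U + <[v]> == U)%VS by rewrite eq_sym eqEdim addvSl.
by move/eqP <-; apply: (subvP (addvSr U _)); apply: memv_line.
Qed.
End Vspace.

Section SelfAdjoint.
Variables (F : numClosedFieldType) (I : finType).
Local Notation V := {ffun I -> F^o}.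

Definition hdot (x y : V) : F := \sum_i (x i : F) * (y i : F)^*.

Lemma hdot_ge0 x : 0 <= hdot x x.
Proof. by apply: sumr_ge0 => i _; apply: mul_conjC_ge0. Qed.

Lemma hdot_eq0 x : hdot x x = 0 -> x = 0.
Proof.
move=> /eqP; rewrite psumr_eq0 => [/allP H|i _]; last exact: mul_conjC_ge0.
apply/ffunP=> i; rewrite ffunE; apply/eqP; rewrite -(mul_conjC_eq0 (x i : F)).
by apply: H; rewrite mem_index_enum.
Qed.

(** If v = S z and S v = 0, then <v, v> = <z, S v> = 0. So the kernel and the image of S meet in 0,
    and by dimension they fill the space. *)
Lemma self_adjoint_split (S : {linear V -> V}) :
  (forall x y, hdot (S x) y = hdot x (S y)) ->
  forall x, exists y z, S y = 0 /\ x = y + S z.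
Proof.
move=> SA x; pose L := linfun S.
have dis : (lker L :&: limg L)%VS = 0%VS.
  apply/eqP; rewrite -subv0; apply/subvP=> v /memv_capP[].
  rewrite memv_ker lfunE => /eqP Sv /memv_imgP[z _]; rewrite lfunE => vz.
  rewrite memv0; apply/eqP/hdot_eq0.
  rewrite {1}vz SA Sv; rewrite /hdot big1 // => i _.
  by rewrite ffunE conjC0 mulr0.
have full : (lker L + limg L)%VS = fullv.
  apply/eqP; rewrite eqEdim subvf /= dimv_disjoint_sum // -(limg_ker_dim L fullv).
  by rewrite capfv.
have : x \in (lker L + limg L)%VS by rewrite full memvf.
case/memv_addP=> y; rewrite memv_ker lfunE => /eqP Sy [v /memv_imgP[z _]].
by rewrite lfunE => -> ->; exists y, z.
Qed.
End SelfAdjoint.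

Section CosetSum.
Variables (F : numClosedFieldType) (gT : finGroupType).
Local Notation V := {ffun gT -> F^o}.

Definition coset_sum (K : {set gT}) (f : V) : V :=
  [ffun w => \sum_(k in K) f (w * k)%g].

Lemma coset_sum_linear K : linear (coset_sum K).
Proof.
move=> a f g; apply/ffunP=> w; rewrite !ffunE scaler_sumr -big_split.
by apply: eq_bigr => k _; rewrite !ffunE.
Qed.

Lemma coset_sum_adj (K : {group gT}) x y :
  hdot (coset_sum K x) y = hdot x (coset_sum K y).
Proof.
rewrite /hdot; under eq_bigr => w _ do rewrite ffunE mulr_suml.
under [RHS]eq_bigr => w _ do rewrite ffunE rmorph_sum mulr_sumr.
rewrite exchange_big [RHS]exchange_big (reindex_inj invg_inj) /=.
apply: eq_big => [k|k kK]; first by rewrite groupV.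
rewrite (reindex_inj (mulIg k)) /=; apply: eq_bigr => w _.
by rewrite mulgK.
Qed.

Lemma coset_sum_right (K : {group gT}) (f : V) w k :
  k \in K -> coset_sum K f (w * k)%g = coset_sum K f w.
Proof.
move=> kK; rewrite !ffunE [RHS](reindex_inj (mulgI k)) /=.
by apply: eq_big => [l|l _]; rewrite ?groupMl // mulgA.
Qed.

Lemma coset_sumK (K : {group gT}) f :
  coset_sum K (coset_sum K f) = #|K|%:R *: coset_sum K f.
Proof.
apply/ffunP=> w; rewrite ffunE (eq_bigr (fun=> coset_sum K f w)).
  by rewrite sumr_const [RHS]ffunE scaler_nat.
by move=> k; apply: coset_sum_right.
Qed.

(** Up to the factor |K|, the coset sum is an orthogonal projection. *)
Lemma coset_sum_ge0 (K : {group gT}) f : 0 <= hdot (coset_sum K f) f.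
Proof.
have nK : 0 < #|K|%:R :> F by rewrite ltr0n cardG_gt0.
rewrite -(pmulr_rge0 _ nK).
suff -> : #|K|%:R * hdot (coset_sum K f) f = hdot (coset_sum K f) (coset_sum K f).
  exact: hdot_ge0.
rewrite -coset_sum_adj coset_sumK /hdot mulr_sumr; apply: eq_bigr => w _.
by rewrite !ffunE mulrA.
Qed.

Lemma coset_sum_eq0 (K : {group gT}) f : hdot (coset_sum K f) f = 0 -> coset_sum K f = 0.
Proof.
move=> H; apply: hdot_eq0; rewrite -coset_sum_adj coset_sumK /hdot.
rewrite (eq_bigr (fun i => #|K|%:R * ((coset_sum K f i : F) * (f i : F)^*))).
  by rewrite -mulr_sumr -/(hdot _ _) H mulr0.
by move=> i _; rewrite mulrA; congr (_ * _); apply: ffunE.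
Qed.
End CosetSum.

(** * Idempotents indexed by descent sets *)

Section DescentIdempotents.
Variables (F : numClosedFieldType) (m : nat).
Local Notation S := 'S_m.+1.
Local Notation V := {ffun S -> F^o}.
Implicit Types (T : {set 'I_m}) (f : V).

Definition young_inv T f := forall w k, k \in young T -> f (w * k)%g = f w.

(* The orthogonal complement, inside the right young T-invariants, of the sum
   of the right young (T :\ t)-invariants for t in T. *)
Definition new_part T f :=
  young_inv T f /\ forall t, t \in T -> coset_sum (young (T :\ t)) f = 0.

Lemma young_inv_subspace T : subspace (young_inv T).
Proof.
split=> [w k _|a f g fT gT w k kT]; first by rewrite !ffunE.
by rewrite !ffunE fT // gT.
Qed.

Lemma coset_sumD K (f g : V) : coset_sum K (f + g) = coset_sum K f + coset_sum K g.
Proof. by rewrite -{1}[f]scale1r coset_sum_linear scale1r. Qed.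

Lemma coset_sum0 K : coset_sum K (0 : V) = 0.
Proof. by apply: (addrI (coset_sum K (0 : V))); rewrite -coset_sumD !addr0. Qed.

Lemma new_part_subspace T : subspace (new_part T).
Proof.
have [i0 iP] := young_inv_subspace T.
split=> [|a f g [fi fc] [gi gc]]; first by split=> // t _; apply: coset_sum0.
split=> [|t tT]; first exact: iP.
by rewrite coset_sum_linear fc // gc // scaler0 addr0.
Qed.

Definition break_sum T f : V := \sum_(t in T) coset_sum (young (T :\ t)) f.

Lemma break_sum_linear T : linear (break_sum T).
Proof.
move=> a f g; rewrite /break_sum scaler_sumr -big_split; apply: eq_bigr => t _.
exact: coset_sum_linear.
Qed.
HB.instance Definition _ T := GRing.isLinear.Build F V V *:%R (break_sum T) (break_sum_linear T).

Lemma hdot_suml I (r : seq I) (P : pred I) (f : I -> V) g :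
  hdot (\sum_(i <- r | P i) f i) g = \sum_(i <- r | P i) hdot (f i) g.
Proof.
rewrite /hdot exchange_big; apply: eq_bigr => w _ /=.
by rewrite sum_ffunE mulr_suml.
Qed.

Lemma hdot_sumr I (r : seq I) (P : pred I) (f : I -> V) g :
  hdot g (\sum_(i <- r | P i) f i) = \sum_(i <- r | P i) hdot g (f i).
Proof.
rewrite /hdot exchange_big; apply: eq_bigr => w _ /=.
by rewrite sum_ffunE rmorph_sum mulr_sumr.
Qed.

(** Split f along the kernel and the image of the self-adjoint [break_sum T]. For y in the kernel,
    <[break_sum T] y, y> = 0 is a sum of nonnegative terms, so every single coset sum kills y. *)
Lemma young_inv_split T f : young_inv T f ->
  exists y (g : 'I_m -> V), [/\ new_part T y,
    forall t, t \in T -> young_inv (T :\ t) (g t) & f = y + \sum_(t in T) g t].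
Proof.
move=> fT.
have SA x y : hdot (break_sum T x) y = hdot x (break_sum T y).
  rewrite hdot_suml hdot_sumr; apply: eq_bigr => t _; exact: coset_sum_adj.
have [y [z [Sy fyz]]] := self_adjoint_split SA f.
exists y, (fun t => coset_sum (young (T :\ t)) z); split=> //; last first.
  by move=> t tT w k; apply: coset_sum_right.
have := congr1 (fun x => hdot x y) Sy; rewrite hdot_suml [RHS]/hdot [RHS]big1; last first.
  by move=> i _; rewrite ffunE mul0r.
move/eqP; rewrite psumr_eq0; last by move=> t _; apply: coset_sum_ge0.
move/allP=> H; split; last first.
  move=> t tT; apply: coset_sum_eq0; apply/eqP.
  by have := H t; rewrite mem_index_enum tT => /(_ isT).
have -> : y = f - break_sum T z by rewrite fyz addrK.
apply: (subspaceB (young_inv_subspace T) fT).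
apply: (subspace_sum (young_inv_subspace T)) => t tT w k kT.
by apply: coset_sum_right; apply: (subsetP (youngS (subsetDl T [set t]))).
Qed.

(** The vanishing coset sums are the relations required by [descent_straightening], used here with
    the zero subspace. *)
Lemma new_part_determined T f :
  new_part T f -> (forall w, Des w = T -> f w = 0) -> f = 0.
Proof.
move=> [fi fc] f0; apply/ffunP=> w; rewrite ffunE.
apply: (@descent_straightening m F F^o (fun x => x = 0) (fun w => f w) T) => //.
  by split=> // a p q -> ->; rewrite scaler0 addr0.
by move=> v t tT; have /ffunP/(_ v) := fc t tT; rewrite !ffunE.
Qed.

(** By [new_part_determined], restriction to the permutations with descent set T is injective on the
    new part. *)
Lemma dim_new_part (U : {vspace V}) T :
  (forall f, f \in U -> new_part T f) -> (\dim U <= #|[set w : S | Des w == T]|)%N.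
Proof.
move=> UT; set D := [set w | _].
pose r f : V := [ffun w => if Des w == T then f w else 0].
have rl : linear r.
  move=> a f g; apply/ffunP=> w; rewrite !ffunE; case: ifP => //.
  by rewrite scaler0 addr0.
pose L := linfun (HB.pack_for {linear V -> V} r (GRing.isLinear.Build F V V *:%R r rl)).
have LE f : L f = r f by rewrite lfunE.
have inj : (U :&: lker L = 0)%VS.
  apply/eqP; rewrite -subv0; apply/subvP=> f /memv_capP[fU].
  rewrite memv_ker LE memv0 => /eqP/ffunP r0; apply/eqP.
  apply: (new_part_determined (UT f fU)) => w wT.
  by have := r0 w; rewrite !ffunE wT eqxx.
rewrite -(limg_dim_eq inj).
pose X := [seq pure_tensor w (1 : F^o) | w <- enum D].
have : (L @: U <= <<X>>)%VS.
  apply/subvP=> v /memv_imgP[f _ ->]; rewrite LE.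
  have -> : r f = \sum_(w <- enum D) (f w : F) *: pure_tensor w (1 : F^o).
    apply/ffunP=> x; rewrite sum_ffunE ffunE big_enum /=.
    case: ifP => xT.
      rewrite (bigD1 x) ?inE //= big1 ?addr0.
        by rewrite !ffunE eqxx [_ *: _]mulr1.
      by move=> i /andP[_ ix]; rewrite !ffunE eq_sym (negPf ix) scaler0.
    rewrite big1 // => i; rewrite inE => iT.
    rewrite !ffunE; case: eqP => [xi|]; last by rewrite scaler0.
    by rewrite xi iT in xT.
  rewrite big_seq; apply: memv_suml => w wD; apply: memvZ; apply: memv_span.
  exact: map_f.
move/dimvS/leq_trans; apply; apply: leq_trans (dim_span _) _.
by rewrite size_map -cardE.
Qed.

(** The new parts are left ideals whose direct sum is the group algebra, and eps_T is the component
    of the unit in the one of T. Right multiplication by eps_T is then the projection onto that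
    ideal, whence orthogonality and the last vanishing. *)
Lemma descent_idempotents : exists eps : {set 'I_m} -> V,
  [/\ \sum_T eps T = pure_tensor 1%g 1,
      forall T, young_inv T (eps T),
      forall T T', conv (eps T) (eps T' : free_gmod S F^o) = if T == T' then eps T else 0 &
      forall T T' f, young_inv T f -> ~~ (T' \subset T) ->
        conv f (eps T' : free_gmod S F^o) = 0].
Proof.
have /choice[N NP] : forall T, exists U : {vspace V}, forall v, v \in U <-> new_part T v.
  by move=> T; apply: subspace_vspace (new_part_subspace T).
have decomp T f : young_inv T f -> f \in (\sum_(T' : {set 'I_m} | T' \subset T) N T')%VS.
  move: {2}#|T|.+1 (ltnSn #|T|) => k; elim: k T f => // k IH T f Tk fT.
  have [y [g [yN gT ->]]] := young_inv_split fT.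
  apply: memvD; first by apply: (subvP (sumv_sup T _ (subvv _))) => //; apply/NP.
  apply: memv_suml => t tT.
  have Tk' : (#|T :\ t| < k)%N by move: Tk; rewrite (cardsD1 t) tT.
  have := IH (T :\ t) (g t) Tk' (gT t tT).
  apply: subvP; apply/subv_sumP => T' T'T; apply: (sumv_sup T') => //.
  by apply: subset_trans T'T _; apply: subsetDl.
have full f : f \in (\sum_T N T)%VS.
  (* The Young subgroup of the full set of breaks is trivial, so every function is invariant under
     it. *)
  have : young_inv setT f.
    move=> w k kT; rewrite (_ : k = 1%g) ?mulg1 //.
    by apply: (young_no_descent (w := 1%g) kT); apply: subsetT.
  move/decomp; apply: subvP; apply/subv_sumP => T' _; exact: (sumv_sup T').
(* The new parts span, and by [sum_Des] the bounds on their dimensions add up to the order of the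
   group; so the sum is direct. *)
have dir : directv (\sum_T N T)%VS.
  rewrite directvEgeq /=.
  have -> : (\sum_T N T)%VS = fullv by apply/eqP; rewrite eqEsubv subvf; apply/subvP=> f _.
  rewrite dimvf; apply: leq_trans (_ : #|{: S}| <= _)%N; last first.
    by rewrite /dim /= muln1.
  rewrite -sum_Des; apply: leq_sum => T _; apply: dim_new_part => f; exact: (NP T f).1.
have uniq (f g : {set 'I_m} -> V) : (forall T, f T \in N T) -> (forall T, g T \in N T) ->
    \sum_T f T = \sum_T g T -> f =1 g.
  move=> fN gN /eqP; have -> := directv_sum_unique dir f g (fun T _ => fN T) (fun T _ => gN T).
  by move=> /forallP H T; apply/eqP; apply: H.
have /memv_sumP [eps epsN deltaE] := full (pure_tensor 1%g (1 : F^o)).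
have {}epsN T : eps T \in N T by apply: epsN.
have left T f g : g \in N T -> conv f (g : free_gmod S F^o) \in N T.
  move=> /NP [gi gc]; apply/NP; split=> [w k kT|t tT].
    rewrite !conv_convE; apply: eq_bigr => x _; rewrite mulgA gi //.
  apply/ffunP=> w; rewrite !ffunE.
  under eq_bigr => k _ do rewrite conv_convE.
  rewrite exchange_big big1 // => x _ /=; rewrite -mulr_sumr.
  have /ffunP/(_ (x^-1 * w)%g) := gc t tT; rewrite !ffunE => H.
  by under eq_bigr => k _ do rewrite mulgA; rewrite H mulr0.
have unit f : conv f (pure_tensor 1%g (1 : F^o) : free_gmod S F^o) = f.
  apply/ffunP=> w; rewrite conv_convE (bigD1 w) //= big1 => [|x xw].
    by rewrite ffunE mulVg eqxx mulr1 addr0.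
  by rewrite ffunE -eq_mulVg1 (negPf xw) mulr0.
have expand f : f = \sum_T conv f (eps T : free_gmod S F^o).
  by rewrite -[LHS]unit deltaE conv_sumr.
exists eps; split=> // [T|T T'|T T' f fT sT].
- by case: ((NP T (eps T)).1 (epsN T)).
- pose g T' := if T == T' then eps T else 0.
  apply: (uniq (fun T' => conv (eps T) (eps T' : free_gmod S F^o)) g).
  + by move=> T1; apply: left.
  + by move=> T1; rewrite /g; case: eqP => [<-|_]; rewrite ?mem0v.
  + rewrite -expand (bigD1 T) //= /g eqxx big1 ?addr0 // => T1.
    by rewrite eq_sym => /negPf->.
- have /memv_sumP [g gN fE] := decomp T f fT.
  pose g' T' := if T' \subset T then g T' else 0.
  rewrite (uniq (fun T' => conv f (eps T' : free_gmod S F^o)) g') /g' ?(negPf sT) //.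
  + by move=> T1; apply: left.
  + by move=> T1; case: ifP => [/gN//|_]; rewrite mem0v.
  + by rewrite -expand fE big_mkcond.
Qed.
End DescentIdempotents.

(** Exchange, one pair at a time, an element of A outside B with an element of B outside A. *)
Lemma perm_swap_sets (T : finType) (A B : {set T}) : #|A| = #|B| ->
  exists2 k : {perm T}, perm_on ((A :\: B) :|: (B :\: A)) k &
    forall i, (k i \in A) = (i \in B).
Proof.
move: {2}#|A :\: B|.+1 (ltnSn #|A :\: B|) => r; elim: r B => // r IH B rB cAB.
have [/eqP|[a]] := set_0Vmem (A :\: B).
  rewrite setD_eq0 => sAB; have /eqP AB : A == B by rewrite eqEcard sAB cAB /=.
  by exists 1%g => [|i]; rewrite ?perm_on1 // perm1 AB.
rewrite inE => /andP[aB aA].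
have [b] : exists b, b \in B :\: A.
  apply/set0Pn; apply: contraTneq aB => BA; rewrite negbK.
  have sBA : B \subset A by rewrite -setD_eq0 BA.
  by have /eqP -> : B == A by rewrite eqEcard sBA cAB /=.
rewrite inE => /andP[bA bB].
have ab : a != b by apply: contraNneq aB => ->.
pose B' := a |: (B :\ b).
have cB' : #|A| = #|B'|.
  by rewrite cAB /B' cardsU1 !inE (negPf aB) andbF /= (cardsD1 b B) bB.
have [|k kon kA] := IH B' _ cB'.
  apply: leq_trans (_ : #|A :\: B| <= _)%N; last by rewrite -ltnS.
  apply: proper_card; apply/properP; split; last first.
    by exists a; rewrite !inE ?aA ?aB ?eqxx.
  apply/subsetP=> x; rewrite !inE negb_or negb_and negbK => /andP[/andP[xa]].
  by case/orP=> [/eqP-> /(negP bA)|->].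
exists (tperm a b * k)%g => [|i].
  apply/subsetP=> x; rewrite !inE permM.
  case: tpermP => [->|->|/eqP xa /eqP xb]; rewrite ?aA ?aB ?bA ?bB ?orbT //=.
  have := subsetP kon x; rewrite !inE => H /H.
  by rewrite (negPf xa) xb.
rewrite permM kA !inE; case: tpermP => [->|->|/eqP xa /eqP xb].
- by rewrite eqxx eq_sym (negPf ab) (negPf aB).
- by rewrite eqxx bB.
- by rewrite (negPf xa) xb.
Qed.

(** * Straightening of monomials *)

Section Monomials.
Variables (F : numFieldType) (m : nat).
Local Notation I := 'I_m.+1.
Local Notation Q := {mpoly F[m.+1 + m.+1]}.
Implicit Types (e f : I -> int) (b : bool) (J : {set I}) (g h w : 'S_m.+1).

(* b selects between the variables x (true) and y (false); a function e stands
   for the monomial with x_k^(e k) or y_k^(- e k), according to the sign of e k. *)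
Definition vr b (k : I) : 'I_(m.+1 + m.+1) :=
  if b then lshift m.+1 k else rshift m.+1 k.

Definition sg b : int := if b then 1 else -1.

Lemma sgK b (z : int) : sg b * (sg b * z) = z.
Proof. by case: b; rewrite /sg; ring. Qed.

Lemma sg_sqr b (z : int) : (sg b * z) ^+ 2 = z ^+ 2.
Proof. by case: b; rewrite /sg; ring. Qed.

Definition zmon e : Q := \prod_k 'X_(vr (0 <= e k)%R k) ^+ absz (e k).

Definition vprod b J : Q := \prod_(j in J) 'X_(vr b j).

Definition esum b d : Q := \sum_(J : {set I} | #|J| == d) vprod b J.

Definition shift b J e : I -> int := fun k => e k + sg b * (k \in J)%:Z.

Definition unshift b J e : I -> int := fun k => e k - sg b * (k \in J)%:Z.

Definition kappa e : nat := \sum_k absz (e k) ^ 2.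

(* With these weights e_d(x) is the leading part of e_d(x) + e_(n+1-d)(y). *)
Definition wb b : nat := if b then m.+2 else 1.

Definition wt e : nat := \sum_k wb (0 <= e k)%R * absz (e k).

Lemma poly_act_var w b k :
  poly_act w ('X_(vr b k) : Q) = 'X_(vr b (w^-1%g k)).
Proof.
rewrite /poly_act /msym mmapX mmap1U [diag_perm _ _]permE /diag_fun /vr.
by case: b; [rewrite (unsplitK (inl k))|rewrite (unsplitK (inr k))].
Qed.

Lemma poly_actMl w (p q : Q) : poly_act w (p * q) = poly_act w p * poly_act w q.
Proof. exact: rmorphM. Qed.

Lemma poly_act_zmon w e : poly_act w (zmon e) = zmon (e \o w).
Proof.
rewrite /poly_act rmorph_prod (reindex_inj (@perm_inj _ w)) /=.
apply: eq_bigr => k _; rewrite rmorphXn /=.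
by have := poly_act_var w (0 <= e (w k)) (w k); rewrite /poly_act => ->; rewrite permK.
Qed.

Lemma poly_act_esum w b d : poly_act w (esum b d) = esum b d.
Proof.
rewrite /poly_act raddf_sum /=.
have inj : injective (fun J : {set I} => w @: J) by apply: imset_inj; apply: perm_inj.
rewrite (reindex_inj inj) /=; apply: eq_big => [J|J _].
  by rewrite card_imset //; apply: perm_inj.
rewrite /vprod rmorph_prod /= big_imset /=; last by move=> ? ? _ _; apply: perm_inj.
apply: eq_bigr => j _.
by have := poly_act_var w b (w j); rewrite /poly_act permK.
Qed.

Lemma kappa_perm e w : kappa (e \o w) = kappa e.
Proof. by rewrite /kappa [RHS](reindex_inj (@perm_inj _ w)). Qed.

Lemma wt_perm e w : wt (e \o w) = wt e.
Proof. by rewrite /wt [RHS](reindex_inj (@perm_inj _ w)). Qed.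

Lemma vprod_zmon b J e : (forall j, j \in J -> 0 <= sg b * e j) ->
  vprod b J * zmon e = zmon (shift b J e).
Proof.
move=> Je; rewrite /vprod /zmon big_mkcond -big_split; apply: eq_bigr => k _ /=.
rewrite /shift; case: ifP => [/Je|_]; last by rewrite mulr0 addr0 mul1r.
rewrite mulr1; move: (e k) => z {Je}; case: b; rewrite /sg ?mul1r ?mulN1r => z0.
  rewrite z0 (addr_ge0 z0) //.
  rewrite (_ : absz (z + 1) = (absz z).+1); last lia.
  by rewrite exprS.
have [->|nz] := eqVneq z 0; first by rewrite expr0 mulr1 expr1.
rewrite (_ : (0 <= z) = false); last lia.
rewrite (_ : (0 <= z - 1) = false); last lia.
by rewrite (_ : absz (z - 1) = (absz z).+1) ?exprS //; lia.
Qed.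

Lemma wt_shift b J e : (forall j, j \in J -> 0 <= sg b * e j) ->
  wt (shift b J e) = (wt e + wb b * #|J|)%N.
Proof.
move=> Je; rewrite /wt -sum1_card big_distrr /= [X in (_ + X)%N]big_mkcond -big_split.
apply: eq_bigr => k _ /=; rewrite /shift; case: ifP => [/Je|_]; last by rewrite mulr0 addr0 addn0.
rewrite mulr1 muln1; move: (e k) => z {Je}; case: b; rewrite /sg ?mul1r ?mulN1r => z0.
  rewrite z0 (addr_ge0 z0) //.
  rewrite (_ : absz (z + 1) = (absz z).+1); last lia.
  by rewrite mulnS addnC.
have [->|nz] := eqVneq z 0; first by rewrite [absz 0]/= muln0.
rewrite (_ : (0 <= z) = false); last lia.
rewrite (_ : (0 <= z - 1) = false); last lia.
by rewrite /wb !mul1n; lia.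
Qed.

Lemma vprod_zmon_xy b J e j : j \in J -> sg b * e j < 0 ->
  exists k (p : Q), vprod b J * zmon e = 'X_(vr true k) * 'X_(vr false k) * p.
Proof.
move=> jJ ej; exists j; rewrite /vprod /zmon (bigD1 j) // [X in _ * X](bigD1 j) //=.
set A := \prod_(i in J | _) _; set B := \prod_(i | _) _.
have -> : (0 <= e j) = ~~ b by clear -ej; case: b ej; rewrite /sg; lia.
have -> : absz (e j) = (absz (e j)).-1.+1 by clear -ej; case: b ej; rewrite /sg; lia.
rewrite exprS; clearbody A B; case: b {ej} => /=.
  by exists (A * 'X_(vr false j) ^+ (absz (e j)).-1 * B); ring.
by exists (A * 'X_(vr true j) ^+ (absz (e j)).-1 * B); ring.
Qed.

Lemma unshiftK b J e : shift b J (unshift b J e) = e.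
Proof. by apply/funext=> k; rewrite /shift /unshift subrK. Qed.

Section Straighten.
Variable W : Q -> Prop.
Hypothesis WS : subspace W.
Hypothesis Wxy : forall k p, W ('X_(vr true k) * 'X_(vr false k) * p).

Lemma esum_zmon b d e (P : Q -> Prop) : subspace P ->
  (forall k p, P ('X_(vr true k) * 'X_(vr false k) * p)) ->
  (forall J, #|J| = d -> (forall j, j \in J -> 0 <= sg b * e j) -> P (zmon (shift b J e))) ->
  P (esum b d * zmon e).
Proof.
move=> PS Pxy PJ; rewrite mulr_suml; apply: (subspace_sum PS) => J /eqP Jd.
have [/forall_inP H|/forall_inPn[j jJ]] := boolP [forall j in J, 0 <= sg b * e j].
  by rewrite vprod_zmon //; apply: PJ.
by rewrite -ltNge => ej; have [k [p ->]] := vprod_zmon_xy jJ ej.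
Qed.

(** As |J| = |K|, the loss [kappa e - kappa eJ] is the sum of the [D i]. With s = [sg b * e i], the
    term [D i] is 2(s - v) on K \ J, 2(v - 1 - s) on J \ K and 0 elsewhere, hence never negative. *)
Lemma kappa_shift b J e (v : int) : let K := [set i | v <= sg b * e i] in
  #|J| = #|K| -> let eJ := shift b J (unshift b K e) in
  (kappa eJ < kappa e)%N \/
  ((forall i, i \in J :\: K -> sg b * e i = v - 1) /\
   (forall i, i \in K :\: J -> sg b * e i = v)).
Proof.
move=> K cJ eJ.
pose D i : int := (sg b * e i) ^+ 2 - (sg b * eJ i) ^+ 2 +
   (2 * v - 1) * ((i \in J)%:Z - (i \in K)%:Z).
have kZ f : (kappa f)%:Z = \sum_i f i ^+ 2.
  rewrite /kappa; rewrite (big_morph Posz PoszD (erefl _)); apply: eq_bigr => i _.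
  by rewrite -abszX gez0_abs // sqr_ge0.
have eJE i : sg b * eJ i = sg b * e i - (i \in K)%:Z + (i \in J)%:Z.
  by rewrite /eJ /shift /unshift mulrDr mulrBr !sgK.
have Di0 i : 0 <= D i.
  rewrite /D eJE; case: (boolP (i \in K)); rewrite inE; case: (i \in J) => /= H; nia.
have sumD : \sum_i D i = (kappa e)%:Z - (kappa eJ)%:Z.
  rewrite /D !big_split /= -mulr_sumr sumrB.
  have cZ (A : {set I}) : \sum_i (i \in A)%:Z = #|A|%:Z.
    rewrite -sum1_card [in RHS]big_mkcond /= (big_morph Posz PoszD (erefl _)).
    by apply: eq_bigr => i _; case: (i \in A).
  rewrite !cZ cJ subrr mulr0 addr0 sumrN !kZ.
  by congr (_ - _); apply: eq_bigr => i _; rewrite sg_sqr.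
have [lt|ge] := ltnP (kappa eJ) (kappa e); first by left.
right.
have /eqP : \sum_i D i = 0.
  apply/eqP; rewrite eq_le sumr_ge0 // andbT sumD; lia.
rewrite psumr_eq0 // => /allP H.
have D0 i : D i = 0 by apply/eqP/H; rewrite mem_index_enum.
split=> i; rewrite !inE => /andP[iK iJ]; have := D0 i; rewrite /D eJE !inE.
  rewrite (negPf iK) iJ /=; nia.
by rewrite (negPf iK) iJ /=; nia.
Qed.

(** Lower z^e by one step on the set K of indices of value at least v, then multiply by e_d with d =
    |K|; since v >= 1, the term of J = K is z^e again. Any other term is a multiple of some x_k y_k,
    has smaller [kappa], or is a rearrangement of z^e inside E, which symmetrization over E
    identifies with z^e. *)
Lemma straighten_sign b e (v : int) :
  (forall d f, (0 < d)%N -> (wt f + wb b * d)%N = wt e -> W (esum b d * zmon f)) ->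
  (forall f, wt f = wt e -> (kappa f < kappa e)%N -> W (zmon f)) ->
  1 <= v -> (exists i, v <= sg b * e i) ->
  forall g, W (poly_act g (\sum_(h | perm_on [set i | (sg b * e i == v) || (sg b * e i == v - 1)] h)
                 poly_act h (zmon e))).
Proof.
move=> Wb IH v1 [i0 vi0] g; set E := [set i | _].
pose K := [set i | v <= sg b * e i]; pose d := #|K|; pose e' := unshift b K e.
have d0 : (0 < d)%N by apply/card_gt0P; exists i0; rewrite inE.
have e'E i : sg b * e' i = sg b * e i - (i \in K)%:Z.
  by rewrite /e' /unshift mulrBr (sgK b).
have e'K i : i \in K -> 0 <= sg b * e' i.
  by move=> iK; rewrite e'E iK; move: iK; rewrite inE; lia.
have wte : wt e = (wt e' + wb b * d)%N by rewrite -wt_shift // unshiftK.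
pose S (p : Q) : Q := poly_act g (\sum_(h | perm_on E h) poly_act h p).
have SS (p q : Q) : S (p + q) = S p + S q.
  rewrite /S /poly_act -raddfD -big_split /=; congr (msym _ _).
  by apply: eq_bigr => h _; rewrite raddfD.
have S0 : S 0 = 0 by apply: (addrI (S 0)); rewrite -SS !addr0.
have WSE p : (forall h, W (poly_act g (poly_act h p))) -> W (S p).
  move=> H; rewrite /S /poly_act raddf_sum; apply: (subspace_sum WS) => h _; exact: H.
have : W (S (esum b d * zmon e')).
  apply: WSE => h; rewrite !poly_actMl !poly_act_esum !poly_act_zmon.
  by apply: Wb => //; rewrite !wt_perm.
(* The terms with the same symmetrization as z^e are only counted: their number is positive because
   J = K is one of them. *)
rewrite /esum mulr_suml (big_morph S SS S0) (bigID (fun J => `[< S (vprod b J * zmon e') = S (zmon e) >])) /=.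
rewrite (eq_bigr (fun=> S (zmon e))); last by move=> J /andP[_ /asboolP].
rewrite sumr_const => H.
set c := #|_| in H.
have c0 : c%:R != 0 :> F.
  rewrite pnatr_eq0 -lt0n; apply/card_gt0P; exists K; rewrite unfold_in /= eqxx /=.
  by apply/asboolP; rewrite vprod_zmon // unshiftK.
apply: (subspace_scaleK WS c0); rewrite scaler_nat.
apply: (subspace_addK WS _ H); apply: (subspace_sum WS) => J /andP[/eqP Jd /asboolP nJ].
have [/forall_inP HJ|/forall_inPn[j jJ]] := boolP [forall j in J, 0 <= sg b * e' j]; last first.
  rewrite -ltNge => ej; have [k [p ->]] := vprod_zmon_xy jJ ej.
  apply: WSE => h; rewrite !poly_actMl !poly_act_var; exact: Wxy.
have [lt|[HJK HKJ]] := kappa_shift Jd.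
  apply: WSE => h; rewrite vprod_zmon // !poly_act_zmon; apply: IH.
    by rewrite !wt_perm wt_shift // wte Jd.
  by rewrite !kappa_perm.
case: nJ; rewrite vprod_zmon //.
have [k kon kK] := perm_swap_sets (esym Jd).
have kE : perm_on E k.
  apply: subset_trans kon _; apply/subsetP=> i; rewrite in_setU => /orP[/HKJ|/HJK] iv.
    by rewrite inE iv eqxx.
  by rewrite inE iv eqxx orbT.
have -> : shift b J e' = e \o k.
  apply/funext=> i; rewrite -[LHS](sgK b) -[RHS](sgK b); congr (_ * _).
  rewrite /shift mulrDr (sgK b) e'E /=.
  have [iD|iD] := boolP (i \in (K :\: J) :|: (J :\: K)); last first.
    rewrite (out_perm kon iD); move: iD; rewrite !in_setU !in_setD.
    by case: (i \in K); case: (i \in J) => //= _; ring.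
  have kiD : k i \in (K :\: J) :|: (J :\: K) by rewrite (perm_closed _ kon).
  move: iD kiD (kK i); rewrite !in_setU.
  case/orP=> [iKJ|iJK].
    rewrite (HKJ i iKJ); case/setDP: iKJ => iK iJ.
    case/orP=> [/setDP[-> _]|kiJK]; first by rewrite (negPf iJ).
    by rewrite (HJK _ kiJK) iK (negPf iJ) addr0.
  rewrite (HJK i iJK); case/setDP: iJK => iJ iK.
  case/orP=> [kiKJ|/setDP[_ /negPf->]]; last by rewrite iJ.
  by rewrite (HKJ _ kiKJ) iJ (negPf iK) subr0 subrK.
rewrite /S; congr (poly_act _ _); rewrite [RHS](reindex_inj (mulIg k)) /=.
apply: eq_big => [h|h _].
  apply/idP/idP => hE; first exact: perm_onM.
  by rewrite -(mulgK k h); apply: perm_onM => //; apply: perm_onV.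
by rewrite !poly_act_zmon; congr zmon; apply/funext=> i /=; rewrite permM.
Qed.

(* The case v >= 1 uses the elementary symmetric functions of the x_k, the case
   v <= 0 those of the y_k. *)
Lemma straighten e (v : int) :
  (forall b d f, (0 < d)%N -> (wt f + wb b * d)%N = wt e -> W (esum b d * zmon f)) ->
  (forall f, wt f = wt e -> (kappa f < kappa e)%N -> W (zmon f)) ->
  (1 <= v /\ exists i, v <= e i) \/ (v <= 0 /\ exists i, e i <= v - 1) ->
  forall g, W (poly_act g (\sum_(h | perm_on [set i | (e i == v) || (e i == v - 1)] h)
                 poly_act h (zmon e))).
Proof.
move=> We IH [[v1 [i iv]]|[v0 [i iv]]] g.
  have := straighten_sign (b := true) (We true) IH v1 _ g.
  rewrite /sg; under eq_finset do rewrite mul1r; apply.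
  by exists i; rewrite mul1r.
(* For the y_k the exponents are negated, and the pair v - 1, v becomes 1 - v, -v, with larger
   member 1 - v. *)
have v1 : 1 <= 1 - v by lia.
have := straighten_sign (b := false) (We false) IH v1 _ g.
rewrite /sg (_ : [set i | _ || _] = [set i | (e i == v) || (e i == v - 1)]); last first.
  by apply/setP=> j; rewrite !inE; lia.
by apply; exists i; lia.
Qed.
End Straighten.
End Monomials.

(** * Decreasing exponents and their codes *)

Section Codes.
Variable m : nat.
Local Notation I := 'I_m.+1.
Implicit Types (e : I -> int) (T : {set 'I_m}) (c i j : I) (t : 'I_m).

Definition breaks_above T i : nat := #|[set t in T | (i <= t)%N]|.

(* The weakly decreasing sequence of integers that drops by one exactly at the
   breaks in T and vanishes at c. *)
Definition code T c : I -> int := fun i => (breaks_above T i)%:Z - (breaks_above T c)%:Z.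

Lemma code_zero T c : code T c c = 0. Proof. by rewrite /code subrr. Qed.

Lemma breaks_above_young T k i : k \in young T -> breaks_above T (k i) = breaks_above T i.
Proof.
move=> /youngP kT; rewrite /breaks_above; congr #|pred_of_set _|.
by apply/setP=> t; rewrite !inE; case: (boolP (t \in T)) => //= /kT ->.
Qed.

Lemma code_young T c k : k \in young T -> code T c \o k = code T c.
Proof. by move=> kT; apply/funext=> i /=; rewrite /code breaks_above_young. Qed.

Lemma breaks_above_lo T t :
  breaks_above T (lo t) = ((t \in T) + breaks_above T (hi t))%N.
Proof.
rewrite /breaks_above [LHS](cardsD1 t) !inE val_lo leqnn andbT; congr (_ + _)%N.
congr #|pred_of_set _|; apply/setP=> s; rewrite !inE.
by rewrite -(inj_eq val_inj) /= /bump; case: (s \in T) => /=; lia.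
Qed.

Lemma code_lo T c t : code T c (lo t) = (t \in T)%:Z + code T c (hi t).
Proof. by rewrite /code breaks_above_lo PoszD addrA. Qed.

Definition decreasing e := forall t, e (hi t) <= e (lo t).

Lemma decreasingP e i j : decreasing e -> (i <= j)%N -> e j <= e i.
Proof.
move=> de; case: j => j jm; elim: j jm => [|j IH] jm ij.
  suff -> : i = Ordinal jm by []. 
  by apply: val_inj => /=; move: ij => /=; lia.
have [E|ne] := eqVneq (i : nat) j.+1.
  suff -> : i = Ordinal jm by []. 
  by apply: val_inj.
have jm' : (j < m)%N by [].
have ij' : (i <= Ordinal (ltnW jm))%N by move: ij ne => /=; lia.
apply: le_trans (IH (ltnW jm) ij').
have := de (Ordinal jm').
suff [-> ->] : hi (Ordinal jm') = Ordinal jm /\ lo (Ordinal jm') = Ordinal (ltnW jm) by [].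
by split; apply: val_inj.
Qed.

Lemma code_decreasing T c : decreasing (code T c).
Proof. by move=> t; rewrite code_lo; lia. Qed.

(** At a maximum of the sum of the -i e(g i), an ascent between t and t+1 could be exchanged for a
    larger value. *)
Lemma exists_decreasing e : exists g : 'S_m.+1, decreasing (e \o g).
Proof.
pose G (g : 'S_m.+1) : int := \sum_(i < m.+1) - (i%:Z * e (g i)).
have [g _ gmax] : exists2 g, true & forall h, G h <= G g.
  by have [g _ H] := arg_maxP (P := predT) G (isT : predT 1%g); exists g => // h; apply: H.
exists g => t; rewrite leNgt; apply/negP=> /= lt.
have := gmax (adj t * g)%g; rewrite /G leNgt => /negP; apply.
have S (f : I -> int) : \sum_(i < m.+1) - (i%:Z * f i) =
    \sum_(i < m.+1 | (i != lo t) && (i != hi t)) - (i%:Z * f i) - (lo t)%:Z * f (lo t)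
    - (hi t)%:Z * f (hi t).
  rewrite (bigD1 (lo t)) //= (bigD1 (hi t)) //= 1?eq_sym ?lo_neq_hi //.
  ring.
rewrite !S; under [X in _ < X - _ - _]eq_bigr => i /andP[i1 i2].
  rewrite permM adjE (negPf i1) (negPf i2); over.
rewrite !permM !adjE !eqxx eq_sym (negPf (lo_neq_hi t)).
have -> : (hi t)%:Z = (lo t)%:Z + 1 by rewrite val_hi -addn1 PoszD.
move: lt; set a := e _; set b := e _; move: ((lo t)%:Z) => x lt.
by rewrite -!addrA ltrD2l; nia.
Qed.

(* At such a v, straighten yields a nonzero multiple of the monomial itself. *)
Definition collapses e (v : int) :=
  ((1 <= v /\ exists i, v <= e i) \/ (v <= 0 /\ exists i, e i <= v - 1)) /\
  forall i j, (e i == v) || (e i == v - 1) -> (e j == v) || (e j == v - 1) -> e i = e j.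

(** c is the last index of its block, hence the last zero of [code T c]. If c = [lo t], then t is
    the first break followed by negative exponents, the first y-break; c = [ord_max] when there is
    none. *)
Definition admissible T c := c = ord_max \/ exists2 t, t \in T & c = lo t.

(** If nothing collapses, every v eligible for straightening occurs together with v - 1. Hence 0
    occurs and no intermediate value is skipped: all drops are by at most one. *)
Lemma decreasing_code e : decreasing e ->
  (exists v, collapses e v) \/ (exists T c, admissible T c /\ e = code T c).
Proof.
move=> de.
have [[v ev]|nc] := pselect (exists v, collapses e v); [by left; exists v|right].
have two v : ((1 <= v /\ exists i, v <= e i) \/ (v <= 0 /\ exists i, e i <= v - 1)) ->
    (exists i, e i = v) /\ exists j, e j = v - 1.
  move=> cv; apply: contrapT => H; apply: nc; exists v; split=> // i j.
  by move=> /orP[] /eqP ei /orP[] /eqP ej; rewrite ei ej //; case: H;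
    split; [exists i|exists j|exists j|exists i].
have [i0 ei0] : exists i, e i = 0.
  have [lt|[lt|e0]] : 1 <= e ord0 \/ (e ord0 <= -1 \/ e ord0 = 0) by lia.
  - have [|_ [j ej]] := two 1; first by left; split=> //; exists ord0.
    by exists j; rewrite ej.
  - have [|[j ej] _] := two 0; first by right; split=> //; exists ord0; lia.
    by exists j.
  - by exists ord0.
pose T := [set t | e (hi t) < e (lo t)].
have step t : e (lo t) = (t \in T)%:Z + e (hi t).
  rewrite inE; case: ltP => [lt|le] /=; last by apply/eqP; rewrite eq_le add0r le de.
  have [[i ei] _] : (exists i, e i = e (hi t) + 1) /\ exists j, e j = e (hi t) + 1 - 1.
    apply: two; have [le|gt] := lerP 0 (e (hi t)).
      by left; split; [lia|exists (lo t); lia].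
    by right; split; [lia|exists (hi t); lia].
  have [it|ti] := leqP i t.
    by have := decreasingP de (it : (i <= lo t)%N); lia.
  by have := decreasingP de (ti : (hi t <= i)%N); lia.
have eT i : e i = (breaks_above T i)%:Z + e ord_max.
  have [k] := ubnP (m - i)%N; elim: k i => // k IH i ik.
  have [E|ne] := eqVneq i ord_max.
    rewrite E /breaks_above (_ : [set _ in _ | _] = set0) ?cards0 ?add0r //.
    by apply/setP=> t; rewrite !inE /= leqNgt ltn_ord andbF.
  have im : (i < m)%N.
    by rewrite ltn_neqAle -ltnS ltn_ord andbT; apply: contra ne => /eqP E; apply/eqP/val_inj.
  have ilo : i = lo (Ordinal im) by apply: val_inj.
  rewrite ilo step breaks_above_lo PoszD -addrA -IH // val_hi /=; lia.
(* Every zero of e gives the same code; the last one is admissible. *)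
pose c := [arg max_(i > i0 | e i == 0) (i : nat)].
have [c0 cmax] : e c == 0 /\ forall j, e j == 0 -> (j <= c)%N.
  by rewrite /c; case: arg_maxnP; [exact/eqP|].
exists T, c; split; last first.
  by apply/funext=> i; rewrite /code eT; have := eT c; rewrite (eqP c0); lia.
have [E|ne] := eqVneq c ord_max; [by left|right].
have cm : (c < m)%N.
  by rewrite ltn_neqAle -ltnS ltn_ord andbT; apply: contra ne => /eqP E; apply/eqP/val_inj.
have clo : c = lo (Ordinal cm) by apply: val_inj.
exists (Ordinal cm) => //; rewrite inE -clo lt_neqAle.
have := de (Ordinal cm); rewrite -clo => ->; rewrite andbT.
apply/negP=> /eqP E; have := cmax (hi (Ordinal cm)); rewrite E c0 => /(_ isT).
by rewrite val_hi /= ltnn.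
Qed.
End Codes.

Section StraightenCodes.
Variables (F : numFieldType) (m : nat).
Local Notation I := 'I_m.+1.
Local Notation Q := {mpoly F[m.+1 + m.+1]}.
Implicit Types (e f : I -> int) (T : {set 'I_m}) (g h w : 'S_m.+1).

Lemma poly_act_mulg g h (p : Q) : poly_act (g * h)%g p = poly_act g (poly_act h p).
Proof. by apply: poly_actM; rewrite inE. Qed.

Lemma poly_act_sum g (J : Type) (r : seq J) (P : pred J) (p : J -> Q) :
  poly_act g (\sum_(i <- r | P i) p i) = \sum_(i <- r | P i) poly_act g (p i).
Proof. exact: (gact_sum (M := poly_gmod F m.+1)). Qed.

Variable W : Q -> Prop.
Hypothesis WS : subspace W.
Hypothesis Wxy : forall k p, W ('X_(vr true k) * 'X_(vr false k) * p).

Lemma straighten_collapse e v :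
  (forall b d f, (0 < d)%N -> (wt f + wb m b * d)%N = wt e -> W (esum F m b d * zmon F f)) ->
  (forall f, wt f = wt e -> (kappa f < kappa e)%N -> W (zmon F f)) ->
  collapses e v -> forall g, W (poly_act g (zmon F e)).
Proof.
move=> We IH [cv one] g; have := straighten WS Wxy We IH cv g.
set E := [set i | _]; rewrite (eq_bigr (fun=> zmon F e)) => [|h hE].
  rewrite poly_act_sum sumr_const -scaler_nat; apply: subspace_scaleK => //.
  by rewrite pnatr_eq0 -lt0n; apply/card_gt0P; exists 1%g; apply: perm_on1.
rewrite poly_act_zmon; congr zmon; apply/funext=> i /=.
have [iE|iE] := boolP (i \in E); last by rewrite (out_perm hE iE).
by apply: one; [have : h i \in E by rewrite (perm_closed _ hE)|]; rewrite ?inE // in iE *.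
Qed.

(** The values v and v - 1 are taken on the two blocks around t, which no break of T' separates. So
    the permutations of these blocks lie in [young T'], and up to a nonzero factor the sum over
    [young T'] is a sum of translates of the straightening relation. *)
Lemma straighten_code T T' c t :
  (forall b d f, (0 < d)%N -> (wt f + wb m b * d)%N = wt (code T c) ->
     W (esum F m b d * zmon F f)) ->
  (forall f, wt f = wt (code T c) -> (kappa f < kappa (code T c))%N -> W (zmon F f)) ->
  t \in T -> T' \subset T :\ t ->
  forall g, W (poly_act g (\sum_(k in young T') poly_act k (zmon F (code T c)))).
Proof.
move=> We IH tT sT g; set e := code T c; pose v := e (lo t).
have ve : e (hi t) = v - 1 by have := code_lo T c t; rewrite tT /v /e; lia.
have cv : (1 <= v /\ exists i, v <= e i) \/ (v <= 0 /\ exists i, e i <= v - 1).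
  have [v1|v0] := lerP 1 v; first by left; split=> //; exists (lo t).
  by right; split; [lia|exists (hi t); rewrite ve].
set E := [set i | (e i == v) || (e i == v - 1)].
have Eside s i : s \in T' -> i \in E -> (i <= s)%N = (t < s)%N.
  move=> /(subsetP sT); rewrite !inE => /andP[st sinT] iE.
  have Ns := code_lo T c s; rewrite sinT -/e in Ns.
  have [ts|st'] := ltnP t s.
    apply: contraTT iE; rewrite -ltnNge => si.
    have := decreasingP (code_decreasing T c) (si : (hi s <= i)%N).
    have := decreasingP (code_decreasing T c) (ts : (hi t <= lo s)%N).
    rewrite -/e; lia.
  apply/negbTE; apply: contraTN iE => is1.
  have lt : (s < t)%N by rewrite ltn_neqAle st' andbT; apply: contra st => /eqP/val_inj->.
  have := decreasingP (code_decreasing T c) (is1 : (i <= lo s)%N).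
  have := decreasingP (code_decreasing T c) (lt : (hi s <= lo t)%N).
  rewrite -/e -/v; lia.
have EY h : perm_on E h -> h \in young T'.
  move=> hE; apply/youngP=> s sT' i.
  have [iE|iE] := boolP (i \in E); last by rewrite (out_perm hE iE).
  by rewrite (Eside _ i sT' iE) Eside // (perm_closed _ hE).
have nz : #|[pred h : 'S_m.+1 | perm_on E h]|%:R != 0 :> F.
  by rewrite pnatr_eq0 -lt0n; apply/card_gt0P; exists 1%g; apply: perm_on1.
apply: (subspace_scaleK WS nz).
suff -> : #|[pred h : 'S_m.+1 | perm_on E h]|%:R *:
    poly_act g (\sum_(k in young T') poly_act k (zmon F e)) =
    \sum_(k in young T') poly_act (g * k)%g (\sum_(h | perm_on E h) poly_act h (zmon F e)).
  by apply: (subspace_sum WS) => k _; apply: straighten.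
under [RHS]eq_bigr => k _ do rewrite poly_act_sum.
rewrite [RHS]exchange_big /= [RHS](eq_bigr (fun=> poly_act g (\sum_(k in young T') poly_act k (zmon F e)))).
  by rewrite scaler_nat; symmetry; exact: (sumr_const [pred h : 'S_m.+1 | perm_on E h]).
move=> h /EY hY; rewrite poly_act_sum [RHS](reindex_inj (mulIg h)) /=.
by apply: eq_big => [k|k _]; rewrite ?groupMr // !poly_act_mulg.
Qed.

(** After sorting, a monomial either collapses or is a code, and the translates of a code satisfy
    the hypotheses of [descent_straightening]. Every step preserves the weight, so only relations
    e_d z^f of weight D enter; this allows the later induction on D. *)
Lemma descent_span D :
  (forall b d f, (0 < d)%N -> (wt f + wb m b * d)%N = D -> W (esum F m b d * zmon F f)) ->
  (forall w c, admissible (Des w) c -> wt (code (Des w) c) = D ->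
     W (poly_act w (zmon F (code (Des w) c)))) ->
  forall e, wt e = D -> W (zmon F e).
Proof.
move=> We base e eD; have [k] := ubnP (kappa e).
elim: k e eD => // k IH e eD ek.
have [g de] := exists_decreasing e.
have -> : zmon F e = poly_act g^-1%g (zmon F (e \o g)).
  by rewrite poly_act_zmon; congr zmon; apply/funext=> i /=; rewrite permKV.
have := wt_perm e g; have := kappa_perm e g; move: (e \o g) (g^-1%g) de => e0 h de K0 W0.
have {}We b d f : (0 < d)%N -> (wt f + wb m b * d)%N = wt e0 -> W (esum F m b d * zmon F f).
  by rewrite W0 eD; apply: We.
have {}IH f : wt f = wt e0 -> (kappa f < kappa e0)%N -> W (zmon F f).
  by rewrite W0 K0 => fD fk; apply: IH; [rewrite fD|lia].
have [[v ev]|[T [c [Tc E]]]] := decreasing_code de; first exact: straighten_collapse ev _.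
rewrite E in We IH *.
apply: (descent_straightening (T := T) (phi := fun w => poly_act w (zmon F (code T c))) WS).
- by move=> w l lT; rewrite poly_act_mulg [poly_act l _]poly_act_zmon code_young.
- move=> w t tT; under eq_bigr => l _ do rewrite poly_act_mulg.
  by rewrite -poly_act_sum; apply: straighten_code tT _ _.
- by move=> w wT; rewrite -wT in Tc E *; apply: base => //; rewrite -E W0.
Qed.

End StraightenCodes.

Section EquivariantSpan.
Variables (F : numClosedFieldType) (m : nat).
Local Notation Q := {mpoly F[m.+1 + m.+1]}.
Implicit Types (f : 'I_m.+1 -> int) (T : {set 'I_m}).

(** Let Y_T be the sum of [young T] and z the monomial of [code T c]. Then Y_T z is a nonzero
    multiple of z; insert the sum of the eps_T' between Y_T and z. The term of T' = T is the base
    case, and Y_T eps_T' = 0 unless T' lies in T. For T' strictly inside T, eps_T' z is proportional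
    to eps_T' Y_T' z, and Y_T' z is straightened. *)
Lemma equivariant_span (W : Q -> Prop) (eps : {set 'I_m} -> {ffun 'S_m.+1 -> F^o}) :
  subspace W ->
  (forall w p, W p -> W (poly_act w p)) ->
  (forall k p, W ('X_(vr true k) * 'X_(vr false k) * p)) ->
  (forall b d f, (0 < d)%N -> W (esum F m b d * zmon F f)) ->
  \sum_T eps T = pure_tensor 1%g 1 ->
  (forall T, young_inv T (eps T)) ->
  (forall T T' (h : {ffun 'S_m.+1 -> F^o}), young_inv T h -> ~~ (T' \subset T) ->
     conv h (eps T' : free_gmod 'S_m.+1 F^o) = 0) ->
  (forall T c, admissible T c ->
     W (conv (M := poly_gmod F m.+1) (eps T) (zmon F (code T c)))) ->
  forall f, W (zmon F f).
Proof.
move=> WS Wact Wxy We eps1 epsY eps0 base e; have [k] := ubnP (kappa e).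
elim: k e => // k IH e ek.
have [g de] := exists_decreasing e.
have -> : zmon F e = poly_act g^-1%g (zmon F (e \o g)).
  by rewrite poly_act_zmon; congr zmon; apply/funext=> i /=; rewrite permKV.
have := kappa_perm e g; move: (e \o g) (g^-1%g) de => e0 h de K0.
apply: (Wact).
have {}IH f : wt f = wt e0 -> (kappa f < kappa e0)%N -> W (zmon F f).
  by rewrite K0 => _ fk; apply: IH; lia.
have {}We b d f : (0 < d)%N -> (wt f + wb m b * d)%N = wt e0 -> W (esum F m b d * zmon F f).
  by move=> d0 _; apply: We.
have [[v ev]|[T [c [Tc E]]]] := decreasing_code de.
  by rewrite -[zmon F e0](poly_act1); apply: straighten_collapse ev _.
rewrite E in We IH *; set z := zmon F (code T c).
have Wconv (f : {ffun 'S_m.+1 -> F^o}) p : W p -> W (conv (M := poly_gmod F m.+1) f p).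
  by move=> Wp; apply: (subspace_sum WS) => w _; apply: (subspaceZ WS); apply: (Wact).
pose Y T' : {ffun 'S_m.+1 -> F^o} := [ffun w => (w \in young T')%:R].
have YE T' p : conv (M := poly_gmod F m.+1) (Y T') p = \sum_(l in young T') poly_act l p.
  exact: conv_indicator.
have Yinv T' : young_inv T' (Y T').
  by move=> w l lT; rewrite !ffunE groupMr.
have Yz : conv (M := poly_gmod F m.+1) (Y T) z = #|young T|%:R *: z.
  rewrite YE (eq_bigr (fun=> z)) ?sumr_const ?scaler_nat // => l lT.
  by rewrite poly_act_zmon code_young.
have nz T' : #|young T'|%:R != 0 :> F by rewrite pnatr_eq0 -lt0n cardG_gt0.
apply: (subspace_scaleK WS (nz T)); rewrite -Yz.
have -> : conv (M := poly_gmod F m.+1) (Y T) z =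
    \sum_T' conv (M := poly_gmod F m.+1) (Y T) (conv (M := poly_gmod F m.+1) (eps T') z).
  by rewrite -conv_sumr -conv_suml eps1 conv_pure gact1.
apply: (subspace_sum WS) => T' _.
have [/eqP E1|ne] := boolP (T' == T); first by apply: Wconv; rewrite E1; apply: base.
have [sT|nT] := boolP (T' \subset T); last first.
  by rewrite -convA (eps0 T) // conv0l; apply: subspace0.
have [t tT tT'] : exists2 t, t \in T & t \notin T'.
  by apply/subsetPn; apply: contra ne => TT'; rewrite eqEsubset sT.
apply: (Wconv (Y T)).
apply: (subspace_scaleK WS (nz T')).
have <- : conv (M := poly_gmod F m.+1) (eps T') (conv (M := poly_gmod F m.+1) (Y T') z) =
    #|young T'|%:R *: conv (M := poly_gmod F m.+1) (eps T') z.
  rewrite -(convA (M := poly_gmod F m.+1)) -convZl; congr (conv _ _).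
  by apply: conv_right_inv; apply: epsY.
apply: (Wconv (eps T')); rewrite YE.
rewrite -[X in W X](poly_act1); apply: (straighten_code WS Wxy We IH tT).
by apply/subsetP=> s sT'; rewrite !inE (subsetP sT) // andbT; apply: contraNneq tT' => <-.
Qed.
End EquivariantSpan.

(** * Evaluation at (n+1)! points *)

Section Points.
Variable F : numClosedFieldType.

(** This is the quotient of X^(a+1) - (-1)^(a+1) by X + 1. *)
Definition trunc_poly (a : nat) : {poly F} := \sum_(i < a.+1) 'X ^+ (a - i) * (-1) ^+ i.

Lemma trunc_polyE a : trunc_poly a = \poly_(j < a.+1) (-1) ^+ (a - j).
Proof.
rewrite poly_def /trunc_poly (reindex_inj rev_ord_inj) /=; apply: eq_bigr => i _.
rewrite subSS subKn -1?ltnS // -[RHS]mul_polyC mulrC.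
by rewrite rmorphXn rmorphN1.
Qed.

Lemma mul_trunc_poly a : ('X + 1) * trunc_poly a = 'X ^+ a.+1 - ((-1) ^+ a.+1)%:P.
Proof. by rewrite rmorphXn rmorphN1 subrXX opprK. Qed.

Lemma separable_trunc_poly a : separable_poly (trunc_poly a).
Proof.
apply: (@dvdp_separable _ ('X ^+ a.+1 - ((-1) ^+ a.+1)%:P)).
  by rewrite -mul_trunc_poly dvdp_mull.
rewrite unlock derivB derivC subr0 derivXn; apply/Bezout_coprimepP.
exists (- (a.+1%:R)%:P, 'X) => /=.
set c := (-1) ^+ a.+1.
have -> : - (a.+1%:R)%:P * ('X ^+ a.+1 - c%:P) + 'X * ('X ^+ a.+1.-1 *+ a.+1) =
    (a.+1%:R * c)%:P :> {poly F}.
  rewrite polyCM mulrnAr -exprS -['X ^+ _ *+ _]mulr_natl !polyC_natr mulrBr !mulNr.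
  by rewrite opprK addrAC addNr add0r.
apply/eqpP; exists (1, a.+1%:R * c) => /=.
  by rewrite oner_eq0 mulf_neq0 ?pnatr_eq0 // signr_eq0.
by rewrite scale1r alg_polyC.
Qed.

(* The negatives of the nontrivial (a+1)-st roots of unity, whose elementary
   symmetric functions are all equal to 1. *)
Lemma trunc_roots a : exists s : seq F, [/\ size s = a, uniq s, 0 \notin s &
  \prod_(z <- s) ('X - z%:P) = trunc_poly a].
Proof.
have sz : size (trunc_poly a) = a.+1.
  by rewrite trunc_polyE size_poly_eq // subnn expr0 oner_eq0.
have lc : lead_coef (trunc_poly a) = 1.
  by rewrite /lead_coef sz trunc_polyE coef_poly /= ltnSn subnn.
have [s sP] := closed_field_poly_normal (trunc_poly a).
rewrite lc scale1r in sP; exists s; split=> //.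
- by apply/eqP; rewrite -eqSS -sz sP size_prod_XsubC.
- by have := separable_trunc_poly a; rewrite sP separable_prod_XsubC.
- rewrite -root_prod_XsubC -sP rootE horner_coef0 trunc_polyE coef_poly /=.
  by rewrite signr_eq0.
Qed.

(** By Vieta, (-1)^k e_k(c) is the coefficient of X^(n-k), which is (-1)^k for k <= a and 0
    beyond. *)
Lemma esym_trunc n (c : 'I_n -> F) a k : (a <= n)%N -> (k <= n)%N ->
  \prod_i ('X - (c i)%:P) = 'X ^+ (n - a) * trunc_poly a ->
  \sum_(J : {set 'I_n} | #|J| == k) \prod_(j in J) c j = (k <= a)%N%:R.
Proof.
move=> an kn cP; rewrite -ltnS in kn.
have := mroots_coeff [tuple c i | i < n] (Ordinal kn); rewrite big_tuple /=.
under eq_bigr => i _ do rewrite tnth_mktuple.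
rewrite cP => E; apply: (mulfI (x := (-1) ^+ k)); first by rewrite signr_eq0.
transitivity ((-1) ^+ k * (mesym n F k).@[tnth [tuple c i | i < n]]).
  congr (_ * _); rewrite /mesym raddf_sum /=; apply: eq_bigr => J _.
  by rewrite rmorph_prod /=; apply: eq_bigr => j _; rewrite mevalXU tnth_mktuple.
rewrite -E coefXnM trunc_polyE coef_poly.
have [ka|ak] := leqP k a.
  rewrite ifF; last lia.
  rewrite ifT; last lia.
  by rewrite mulr1; congr (_ ^+ _); lia.
by rewrite mulr0 ifT //; lia.
Qed.

(** Multiply, over all y other than x, affine functions equal to 1 at x and 0 at y. *)
Lemma interpolation (X : finType) N (pt : X -> 'I_N -> F) :
  (forall x y, x != y -> exists i, pt x i != pt y i) ->
  forall x, exists p : {mpoly F[N]}, forall y, p.@[pt y] = (x == y)%:R.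
Proof.
move=> sep x.
have /choice[q qP] y : exists q : {mpoly F[N]}, q.@[pt x] = 1 /\ (x != y -> q.@[pt y] = 0).
  have [->|/sep[i ne]] := eqVneq x y; first by exists 1; rewrite meval1.
  exists ((pt x i - pt y i)^-1 *: ('X_i - (pt y i)%:MP)).
  rewrite !mevalZ !mevalB !mevalXU !mevalC subrr mulr0; split=> //.
  by rewrite mulVf // subr_eq0.
exists (\prod_y q y) => y; rewrite rmorph_prod /=.
have [<-|ne] := eqVneq x y.
  by rewrite big1 // => z _; case: (qP z).
by rewrite (bigD1 y) //= (qP y).2 // mul0r.
Qed.

Variable m : nat.
Local Notation n := m.+1.
Local Notation Q := {mpoly F[n + n]}.

Definition point_type : finType := ('S_n * 'I_n.+1)%type.

Variable rt : nat -> seq F.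
Hypothesis rtP : forall a, [/\ size (rt a) = a, uniq (rt a), 0 \notin rt a &
  \prod_(z <- rt a) ('X - z%:P) = trunc_poly a].

(* At these points e_d(x) + e_(n+1-d)(y) = 1 for all 1 <= d <= n. *)
Definition point (q : point_type) (k : 'I_(n + n)) : F :=
  match split k with
  | inl i => if (q.1 i < q.2)%N then (rt q.2)`_(q.1 i) else 0
  | inr i => if (q.1 i < q.2)%N then 0 else (rt (n - q.2))`_(q.1 i - q.2)
  end.

Lemma point_x q i :
  point q (vr true i) = if (q.1 i < q.2)%N then (rt q.2)`_(q.1 i) else 0.
Proof. by rewrite /point /vr (unsplitK (inl i)). Qed.

Lemma point_y q i :
  point q (vr false i) = if (q.1 i < q.2)%N then 0 else (rt (n - q.2))`_(q.1 i - q.2).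
Proof. by rewrite /point /vr (unsplitK (inr i)). Qed.

Lemma rt_neq0 a j : (j < a)%N -> (rt a)`_j != 0.
Proof.
have [sz _ n0 _] := rtP a => ja; apply: contraNneq n0 => <-.
by rewrite mem_nth // sz.
Qed.

Lemma point_neq0 q b i : (point q (vr b i) != 0) = (b == (q.1 i < q.2)%N).
Proof.
case: b; rewrite ?point_x ?point_y; case: ltnP => H; rewrite ?eqxx //.
  by rewrite rt_neq0.
by rewrite rt_neq0 //; move: (ltn_ord (q.1 i)) H; lia.
Qed.

(** The number of nonzero x-coordinates is [q.2]; as the roots are distinct, the coordinates of
    index i then determine [q.1 i]. *)
Lemma point_sep x y : x != y -> exists i, point x i != point y i.
Proof.
move=> ne; apply: contrapT => same; case/eqP: ne.
have {}same i : point x i = point y i.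
  by apply/eqP; apply: contrapT => H; apply: same; exists i; apply/negP.
have pos i : (x.1 i < x.2)%N = (y.1 i < y.2)%N.
  have := point_neq0 x true i; rewrite same point_neq0.
  by case: (_ < _)%N; case: (_ < _)%N.
have card (q : point_type) : #|[set i | (q.1 i < q.2)%N]| = q.2.
  rewrite -(card_imset _ (@perm_inj _ q.1)).
  have -> : q.1 @: [set i | (q.1 i < q.2)%N] = [set j : 'I_n | (j < q.2)%N].
    apply/setP=> j; rewrite inE; apply/imsetP/idP => [[i + ->]|jq]; first by rewrite inE.
    by exists (q.1^-1%g j); rewrite ?inE permKV.
  rewrite -sum1_card (eq_bigl (fun j : 'I_n => (j < q.2)%N)); last by move=> j; rewrite inE.
  by rewrite (big_ord_narrow (leq_ord q.2)) sum1_card card_ord.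
have e2 : x.2 = y.2.
  apply: val_inj; rewrite /= -[LHS](card x) -[RHS](card y); congr #|pred_of_set _|.
  by apply/setP=> i; rewrite !inE pos.
have e1 : x.1 = y.1.
  apply/permP=> i; apply: val_inj.
  have [lt|ge] := boolP (x.1 i < x.2)%N.
    have := same (vr true i); rewrite !point_x -pos lt e2 => /eqP.
    rewrite nth_uniq; first by move/eqP.
    - by case: (rtP y.2) => -> _ _ _; rewrite -e2.
    - by case: (rtP y.2) => -> _ _ _; rewrite -pos.
    - by case: (rtP y.2).
  have := same (vr false i); rewrite !point_y -pos (negPf ge) e2 => /eqP.
  have ge' : ~~ (y.1 i < y.2)%N by rewrite -pos.
  rewrite e2 in ge; rewrite nth_uniq.
  - by move/eqP=> E; rewrite -leqNgt in ge; rewrite -leqNgt in ge'; rewrite /= -(subnK ge) E subnK.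
  - by case: (rtP (n - y.2)) => -> _ _ _; move: (ltn_ord (x.1 i)) ge; lia.
  - by case: (rtP (n - y.2)) => -> _ _ _; move: (ltn_ord (y.1 i)) ge'; lia.
  - by case: (rtP (n - y.2)).
by rewrite [x]surjective_pairing e1 e2 -surjective_pairing.
Qed.

Lemma prod_rt a (f : nat -> F) : (forall j, (j < a)%N -> f j = (rt a)`_j) ->
  \prod_(j < a) ('X - (f j)%:P) = trunc_poly a.
Proof.
move=> fE; have [sz _ _ <-] := rtP a.
rewrite (big_nth 0) sz big_mkord; apply: eq_bigr => j _; by rewrite fE.
Qed.

(** Reindexed by [q.1], the coordinates are zeros and a full set of roots of some [trunc_poly], so
    [esym_trunc] applies. *)
Lemma esum_point q b d : (0 < d <= n)%N ->
  (esum F m b d).@[point q] = (d <= if b then (q.2 : nat) else (n - q.2)%N)%N%:R.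
Proof.
move=> /andP[d0 dn]; rewrite /esum raddf_sum /=.
transitivity (\sum_(J : {set 'I_n} | #|J| == d) \prod_(j in J) point q (vr b j)).
  by apply: eq_bigr => J _; rewrite rmorph_prod /=; apply: eq_bigr => j _; rewrite mevalXU.
have qn : (q.2 <= n)%N by rewrite -ltnS.
apply: esym_trunc => //; first by case: b; rewrite ?leq_subr.
rewrite (reindex_inj (@perm_inj _ q.1^-1%g)) /=; case: b.
  under eq_bigr => i _ do rewrite point_x permKV.
  rewrite (eq_bigr (fun i : 'I_n => 'X - (if (i < q.2)%N then (rt q.2)`_i else 0)%:P)) //.
  rewrite -(big_mkord predT (fun i => 'X - (if (i < q.2)%N then (rt q.2)`_i else 0)%:P)).
  rewrite (big_cat_nat (leq0n _) qn) //= mulrC; congr (_ * _); last first.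
    rewrite big_mkord; apply: (prod_rt (f := fun i => if (i < q.2)%N then (rt q.2)`_i else 0)).
    by move=> j ->.
  rewrite big_nat (eq_bigr (fun=> 'X)) => [|i /andP[qi _]].
    by rewrite -big_nat prodr_const_nat.
  by rewrite ltnNge qi subr0.
under eq_bigr => i _ do rewrite point_y permKV.
rewrite subKn //.
rewrite -(big_mkord predT (fun i => 'X - (if (i < q.2)%N then 0 else (rt (n - q.2))`_(i - q.2))%:P)).
rewrite (big_cat_nat (leq0n _) qn) //=; congr (_ * _).
  rewrite big_nat (eq_bigr (fun=> 'X)) => [|i /andP[_ qi]].
    by rewrite -big_nat prodr_const_nat subn0.
  by rewrite qi subr0.
rewrite -{1}[nat_of_ord q.2]add0n big_addn big_mkord.
apply: (prod_rt (f := fun i => if (i + q.2 < q.2)%N then 0 else (rt (n - q.2))`_(i + q.2 - q.2))).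
by move=> j _; rewrite addnK ifF //; lia.
Qed.

Lemma zmon_point (e : 'I_n -> int) q : (zmon F e).@[point q] != 0 ->
  forall i, (0 < e i -> (q.1 i < q.2)%N) /\ (e i < 0 -> (q.2 <= q.1 i)%N).
Proof.
rewrite /zmon rmorph_prod /= => /prodf_neq0 H i.
have {H} := H i isT; rewrite rmorphXn /= mevalXU => H.
have H0 : e i != 0 -> ((0 <= e i) == (q.1 i < q.2)%N).
  rewrite -point_neq0 => ei; apply: contraNneq H => ->.
  by rewrite expr0n absz_eq0 (negPf ei).
split=> ei; have := H0.
  by rewrite (gt_eqF ei) (ltW ei) => /(_ isT) /eqP <-.
by rewrite (lt_eqF ei) leNgt ei /= => /(_ isT) /eqP; case: ltnP.
Qed.

Lemma card_below k : (k <= n)%N -> #|[set i : 'I_n | (i < k)%N]| = k.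
Proof.
move=> kn; rewrite -sum1_card (eq_bigl (fun j : 'I_n => (j < k)%N)) => [|j]; last by rewrite inE.
by rewrite (big_ord_narrow kn) sum1_card card_ord.
Qed.

Definition poss (e : 'I_n -> int) := [set i | 0 < e i].
Definition negs (e : 'I_n -> int) := [set i | e i < 0].

Lemma card_poss_point e q : (zmon F e).@[point q] != 0 -> (#|poss e| <= q.2)%N.
Proof.
move=> /zmon_point H; rewrite -[X in (_ <= X)%N]card_below -1?ltnS //.
rewrite -(card_imset _ (@perm_inj _ q.1)); apply/subset_leq_card/subsetP=> _ /imsetP[i + ->].
by rewrite !inE; apply: (H i).1.
Qed.

Lemma card_negs_point e q : (zmon F e).@[point q] != 0 -> (#|negs e| <= n - q.2)%N.
Proof.
move=> /zmon_point H; have qn : (q.2 <= n)%N by rewrite -ltnS.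
have -> : (n - q.2)%N = #|~: [set i : 'I_n | (i < q.2)%N]|.
  by rewrite cardsCs setCK card_below // card_ord.
rewrite -(card_imset _ (@perm_inj _ q.1)).
apply/subset_leq_card/subsetP=> _ /imsetP[i + ->].
by rewrite !inE -leqNgt; apply: (H i).2.
Qed.

Lemma esum_large b d : (n < d)%N -> esum F m b d = 0.
Proof.
move=> nd; rewrite /esum big1 // => J /eqP Jd.
by have := max_card (pred_of_set J); rewrite card_ord Jd leqNgt nd.
Qed.

Lemma xy_point (k : 'I_n) (p : Q) q : ('X_(vr true k) * 'X_(vr false k) * p).@[point q] = 0.
Proof.
rewrite !mevalM !mevalXU point_x point_y.
by case: ifP; rewrite ?mul0r ?mulr0 ?mul0r.
Qed.

(** Exactly one of d <= [q.2] and n + 1 - d <= n - [q.2] holds. *)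
Lemma theta_point d q : (0 < d <= n)%N ->
  (esum F m true d + esum F m false (n.+1 - d)%N).@[point q] = 1.
Proof.
move=> /andP[d0 dn]; have qn : (q.2 <= n)%N by rewrite -ltnS.
rewrite mevalD !esum_point; try lia.
have [le|gt] := leqP d q.2; first by rewrite (_ : (_ <= _)%N = false) ?addr0 //; lia.
by rewrite (_ : (_ <= _)%N = true) ?add0r //; lia.
Qed.

(** Where z^e does not vanish, at least j of the y_k are nonzero, and e_j(y) = 1 there. *)
Lemma esum_negs_point (e : 'I_n -> int) j q : (0 < j <= n)%N -> (j <= #|negs e|)%N ->
  (esum F m false j * zmon F e).@[point q] = (zmon F e).@[point q].
Proof.
move=> jn le; rewrite mevalM esum_point //.
have [->|/card_negs_point nz] := eqVneq (zmon F e).@[point q] 0; first by rewrite mulr0.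
by rewrite (leq_trans le nz) mul1r.
Qed.

(** Where z^e does not vanish, more than n - j of the x_k are nonzero, so fewer than j of the y_k
    are, and e_j(y) = 0. *)
Lemma esum_poss_point (e : 'I_n -> int) j q : (0 < j <= n)%N -> (n - j < #|poss e|)%N ->
  (esum F m false j * zmon F e).@[point q] = 0.
Proof.
move=> jn le; rewrite mevalM esum_point //.
have [->|/card_poss_point nz] := eqVneq (zmon F e).@[point q] 0; first by rewrite mulr0.
by rewrite (_ : (_ <= _)%N = false) ?mul0r //; lia.
Qed.

(** * Spanning the functions on the points *)

Section LowerBound.
Variable W : Q -> Prop.
Hypothesis WS : subspace W.
Hypothesis Wpoint : forall p p', (forall q, p.@[point q] = p'.@[point q]) -> W p -> W p'.
(** A descent monomial of weight D is granted only once the smaller weights and the relations of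
    weight D are. This is what permits one member of the family to be left out and recovered from a
    linear relation. *)
Hypothesis Wbase : forall D, (forall f, (wt f < D)%N -> W (zmon F f)) ->
  (forall b d f, (0 < d)%N -> (wt f + wb m b * d)%N = D -> W (esum F m b d * zmon F f)) ->
  forall w c, admissible (Des w) c -> wt (code (Des w) c) = D ->
    W (poly_act w (zmon F (code (Des w) c))).
(** With those of [Wstar], these products bring the number of spanning functions up to (n+1)!. *)
Hypothesis Wasc : forall (w : 'S_n) (t : 'I_m), t \notin Des w ->
  W (esum F m false (m - t)%N * poly_act w (zmon F (code (Des w) (lo t)))).
Hypothesis Wstar : forall w : 'S_n,
  W (esum F m false n * poly_act w (zmon F (code (Des w) ord0))).

Lemma W0_point p : (forall q, p.@[point q] = 0) -> W p.
Proof.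
move=> p0; apply: (Wpoint _ (subspace0 WS)) => q; by rewrite p0 meval0.
Qed.

Lemma Wxy_point k p : W ('X_(vr true k) * 'X_(vr false k) * p).
Proof. by apply: W0_point => q; rewrite xy_point. Qed.

Lemma Wmul_xy (a : Q) k p : W (a * ('X_(vr true k) * 'X_(vr false k) * p)).
Proof. by apply: W0_point => q; rewrite mevalM xy_point mulr0. Qed.

Lemma subspace_mul (a : Q) : subspace (fun p => W (a * p)).
Proof.
split=> [|c p q pW qW]; first by rewrite mulr0; apply: subspace0.
by rewrite mulrDr -scalerAr; apply: WS.2.
Qed.

Section Degree.
Variable D : nat.
Hypothesis IH : forall f, (wt f < D)%N -> W (zmon F f).

(** On the points e_d(x) is 1 - e_(n+1-d)(y). Since each x_k has weight n + 1, which exceeds the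
    weight n + 1 - d of e_(n+1-d)(y), both resulting terms have weight below D. *)
Lemma Wesum_x d f : (0 < d)%N -> (wt f + m.+2 * d)%N = D -> W (esum F m true d * zmon F f).
Proof.
move=> d0 fD; have big := leq_pmulr m.+2 d0; have [nd|dn] := ltnP n d.
  by rewrite esum_large // mul0r; apply: subspace0.
apply: (Wpoint (p := zmon F f - esum F m false (n.+1 - d)%N * zmon F f)) => [q|].
  rewrite mevalB !mevalM -{1}[(zmon F f).@[_]]mul1r -(theta_point (d := d) q) ?d0 //.
  by rewrite mevalD mulrDl addrK.
apply: (subspaceB WS); first by apply: IH; lia.
apply: (esum_zmon WS Wxy_point) => J Jd Jf; apply: IH.
by rewrite wt_shift // Jd /wb mul1n; lia.
Qed.

(** The monomials of e_j(y) z^f involve at least j of the y_k, so e_i(y) acts on them as 1 on the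
    points, and their weight is D - i. *)
Lemma Wesum_yy i j f : (0 < i)%N -> (i <= j)%N -> (wt f + i + j)%N = D ->
  W (esum F m false i * (esum F m false j * zmon F f)).
Proof.
move=> i0 ij fD; have [nj|jn] := ltnP n j.
  by rewrite (esum_large false nj) mul0r mulr0; apply: subspace0.
apply: (esum_zmon (subspace_mul _) (Wmul_xy _)) => J Jj Jf.
apply: (Wpoint (p := zmon F (shift false J f))) => [q|].
  rewrite esum_negs_point ?i0 ?(leq_trans ij) //.
  rewrite -Jj; apply/subset_leq_card/subsetP=> k kJ; rewrite inE /shift kJ.
  by have := Jf k kJ; rewrite /sg; lia.
by apply: IH; rewrite wt_shift // Jj /wb mul1n; lia.
Qed.

(** On the points e_j(y) acts as 1 if at least j exponents are negative, and as 0 if more than n - j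
    are positive. The case of exactly n - j positive exponents goes back to [Wesum_x] or [Wstar],
    and the rest to [Wasc]. *)
Lemma Wesum_y_code j (w : 'S_n) c : (0 < j)%N -> admissible (Des w) c ->
  (wt (code (Des w) c) + j)%N = D ->
  W (esum F m false j * poly_act w (zmon F (code (Des w) c))).
Proof.
move=> j0 Tc eD; set T := Des w in Tc eD *.
have [nj|jn] := ltnP n j.
  by rewrite (esum_large false nj) mul0r; apply: subspace0.
have j0n : (0 < j <= n)%N by rewrite j0.
rewrite poly_act_zmon; set e := code T c \o w.
have wte : (wt e + j)%N = D by rewrite wt_perm.
have [negj|negj] := leqP j #|negs e|.
  apply: (Wpoint (p := zmon F e)) => [q|]; first by rewrite esum_negs_point.
  by apply: IH; lia.
have [posj|] := ltnP (n - j) #|poss e|.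
  by apply: W0_point => q; apply: esum_poss_point.
rewrite leq_eqVlt => /orP[/eqP pj|posj].
  have [p0|p0] := posnP #|poss e|.
    have jE : j = n by lia.
    have c0 : code T c ord0 = 0.
      apply/eqP; rewrite eq_le -[X in _ && (X <= _)](code_zero T c).
      rewrite (decreasingP (@code_decreasing _ T c)) // andbT leNgt.
      move/eqP: p0; rewrite cards_eq0 => /eqP/setP/(_ (w^-1%g ord0)).
      by rewrite !inE /e /= permKV => ->.
    have := Wstar w; rewrite jE -/T poly_act_zmon /e.
    suff -> : code T ord0 = code T c by [].
    by apply/funext=> i; move: c0; rewrite /code; lia.
  apply: (esum_zmon WS Wxy_point) => J Jj Je.
  have JE : J = ~: poss e.
    apply/eqP; rewrite eqEcard; apply/andP; split.
      apply/subsetP=> i /Je; rewrite !inE /sg; lia.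
    by rewrite cardsCs setCK pj card_ord Jj; lia.
  (* Only the complement J of the positive indices contributes. The same monomial arises from
     e_(n-j)(x) times the monomial with all exponents lowered by one, where it is the only term
     outside the multiples of x_k y_k. *)
  have E : shift true (poss e) (fun i => e i - 1) = shift false J e.
    apply/funext=> i; rewrite /shift JE !inE /sg.
    by case: (0 < e i) => /=; lia.
  have pe : forall i, i \in poss e -> 0 <= sg true * (e i - 1).
    by move=> i; rewrite inE /sg; lia.
  rewrite -E; have : W (esum F m true #|poss e| * zmon F (fun i => e i - 1)).
    apply: Wesum_x => //.
    have := wt_shift (b := true) pe; rewrite E wt_shift // Jj /wb.
    by rewrite mul1n => <-.
  rewrite /esum mulr_suml (bigD1 (poss e)) //= vprod_zmon //.
  move=> H; apply: (subspace_addK WS _ H); apply: (subspace_sum WS) => K /andP[/eqP cK KP].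
  have /subsetPn[i iK iP] : ~~ (K \subset poss e).
    by apply: contra KP => sK; rewrite eqEcard sK cK /=.
  have [] := @vprod_zmon_xy F m true K (fun i => e i - 1) i iK.
    by move: iP; rewrite inE /sg; lia.
  by move=> k [p ->]; apply: Wxy_point.
(* t separates the first n - j indices from the last j. With fewer than n - j positive exponents the
   code is at most 0 at [lo t]; with fewer than j negative ones it is at least 0 at [hi t]. So both
   values are 0 and t is not a break. *)
have tm : ((n - j).-1 < m)%N by lia.
pose t := Ordinal tm.
have cpos : #|poss (code T c)| = #|poss e|.
  rewrite -(card_imset (poss e) (@perm_inj _ w)); congr #|pred_of_set _|.
  apply/setP=> i; apply/idP/imsetP => [ip|[k kp ->]]; last by move: kp; rewrite !inE.
  by exists (w^-1%g i); rewrite ?permKV // inE /e /= permKV; rewrite inE in ip.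
have cneg : #|negs (code T c)| = #|negs e|.
  rewrite -(card_imset (negs e) (@perm_inj _ w)); congr #|pred_of_set _|.
  apply/setP=> i; apply/idP/imsetP => [ip|[k kp ->]]; last by move: kp; rewrite !inE.
  by exists (w^-1%g i); rewrite ?permKV // inE /e /= permKV; rewrite inE in ip.
have lo0 : code T c (lo t) <= 0.
  rewrite leNgt; apply/negP=> pt; move: posj; rewrite -cpos ltnNge => /negP; apply.
  rewrite -(card_below (leq_subr j n)); apply/subset_leq_card/subsetP=> i; rewrite !inE => ij.
  apply: lt_le_trans pt _; apply: (decreasingP (@code_decreasing _ T c)) => /=; lia.
have hi0 : 0 <= code T c (hi t).
  rewrite leNgt; apply/negP=> pt; move: negj; rewrite -cneg ltnNge => /negP; apply.
  have -> : j = #|~: [set i : 'I_n | (i < n - j)%N]|.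
    by rewrite cardsCs setCK card_below ?leq_subr // card_ord subKn.
  apply/subset_leq_card/subsetP=> i; rewrite !inE => ij.
  apply: le_lt_trans pt; apply: (decreasingP (@code_decreasing _ T c)); rewrite val_hi /=; lia.
have := code_lo T c t => Elo.
have tT : t \notin T by apply/negP=> tT; move: Elo; rewrite tT; lia.
have := Wasc tT; rewrite (_ : (m - t)%N = j); last by rewrite /=; lia.
rewrite poly_act_zmon /e -/T; suff -> : code T (lo t) = code T c by [].
have c0 : code T c (lo t) = 0 by move: Elo; rewrite (negPf tT); lia.
by apply/funext=> i; move: c0; rewrite /code; lia.
Qed.

(** Apply [descent_span] to the subspace of the p with e_j(y) p in W, which leaves only translated
    codes. The products e_j(y) e_d z^f' that it requires fall under [Wesum_x], after expanding
    e_j(y), or under [Wesum_yy]. *)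
Lemma Wesum_y j f : (0 < j)%N -> (wt f + j)%N = D -> W (esum F m false j * zmon F f).
Proof.
move=> j0 fD; apply: (descent_span (D := wt f) (subspace_mul _) (Wmul_xy _)) => //.
  move=> [] d f' d0 E; rewrite /wb in E; rewrite mulrCA.
    apply: (esum_zmon (subspace_mul _) (Wmul_xy _)) => J Jj Jf.
    by apply: Wesum_x => //; rewrite wt_shift // Jj /wb; lia.
  have [le|/ltnW le] := leqP d j; first by apply: Wesum_yy => //; lia.
  by rewrite mulrCA; apply: Wesum_yy => //; lia.
by move=> w c Tc E; apply: Wesum_y_code => //; rewrite E.
Qed.
End Degree.

Lemma lower_bound_span f : W (zmon F f).
Proof.
have [k] := ubnP (wt f); elim: k f => // k IH f fk.
have {}IH f' : (wt f' < wt f)%N -> W (zmon F f') by move=> lt; apply: IH; lia.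
have We b d f' : (0 < d)%N -> (wt f' + wb m b * d)%N = wt f -> W (esum F m b d * zmon F f').
  case: b => d0 E; first exact: (Wesum_x IH).
  by apply: (Wesum_y IH) => //; rewrite -E /wb mul1n.
by apply: (descent_span WS Wxy_point We) => // w c; apply: Wbase.
Qed.
End LowerBound.
End Points.

(** * Independence of the descent monomials *)

Section DescentMonomials.
Variables (F : numClosedFieldType) (m : nat).
Local Notation n := m.+1.
Local Notation Q := {mpoly F[n + n]}.

Definition coinv_rel (p : Q) : Prop :=
  (exists k, p = 'X_(vr true k) * 'X_(vr false k)) \/
  (exists b d, (0 < d)%N /\ p = esum F m b d).

Definition var_weight (i : 'I_(n + n)) : nat :=
  wb m (if split i is inl _ then true else false).

Definition weight (M : 'X_{1..n + n}) : nat := \sum_i M i * var_weight i.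

Lemma weight0 : weight 0%MM = 0%N.
Proof. by rewrite /weight big1 // => i _; rewrite mnm0E. Qed.

Lemma weightD : {morph weight : M N / (M + N)%MM >-> (M + N)%N}.
Proof.
move=> M N; rewrite /weight -big_split; apply: eq_bigr => i _.
by rewrite mnmDE mulnDl.
Qed.
HB.instance Definition _ := isMeasure.Build (n + n)%N weight weight0 weightD.

Lemma homog_var b k : ('X_(vr b k) : Q) \is (wb m b).-homog for weight.
Proof.
rewrite dhomogX; apply/eqP; change (weight U_(vr b k)%MM = wb m b); rewrite /weight (bigD1 (vr b k)) //= mnm1E eqxx mul1n big1 ?addn0.
  by rewrite /var_weight /vr; case: b; rewrite ?(unsplitK (inl k)) ?(unsplitK (inr k)).
by move=> i ik; rewrite mnm1E eq_sym (negPf ik).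
Qed.

Lemma homog_prodr (J : finType) (P : pred J) (f : J -> Q) (d : J -> nat) :
  (forall i, P i -> f i \is (d i).-homog for weight) ->
  \prod_(i | P i) f i \is (\sum_(i | P i) d i).-homog for weight.
Proof.
move=> H; apply: (big_ind2 (fun (p : Q) e => p \is e.-homog for weight)) => //.
  exact: dhomog1.
by move=> p e q g; apply: dhomogM.
Qed.

Lemma homog_zmon e : zmon F e \is (wt e).-homog for weight.
Proof. by apply: homog_prodr => k _; apply/dhomogMn/homog_var. Qed.

Lemma homog_esum b d : esum F m b d \is (wb m b * d).-homog for weight.
Proof.
apply: rpred_sum => J /eqP <-; rewrite -sum1_card big_distrr /=.
by apply: homog_prodr => k _; rewrite muln1; apply: homog_var.
Qed.

Lemma monomial_cases (M : 'X_{1..n + n}) :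
  (exists k (p : Q), 'X_[M] = 'X_(vr true k) * 'X_(vr false k) * p) \/
  (exists e, 'X_[M] = zmon F e).
Proof.
have XE : 'X_[M] = (\prod_(k < n) 'X_(vr true k) ^+ M (vr true k)) *
    \prod_(k < n) 'X_(vr false k) ^+ M (vr false k) :> Q.
  by rewrite mpolyXE_id big_split_ord.
have [k /andP[k1 k2]|none] := pickP (fun k => (0 < M (vr true k)) && (0 < M (vr false k)))%N.
  left; exists k; rewrite XE (bigD1 k) // [X in _ * X](bigD1 k) //=.
  rewrite -(prednK k1) -(prednK k2) !exprS.
  set A := \prod_(i | _) _; set B := \prod_(i | _) _.
  exists ('X_(vr true k) ^+ (M (vr true k)).-1 * A * ('X_(vr false k) ^+ (M (vr false k)).-1 * B)).
  clearbody A B; ring.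
right; exists (fun k => (M (vr true k))%:Z - (M (vr false k))%:Z).
rewrite XE -big_split; apply: eq_bigr => k _ /=.
have := none k; move: (M (vr true k)) (M (vr false k)) => a b.
have [->|b0] := posnP b; first by rewrite subr0 expr0 mulr1.
have [->|a0] := posnP a; last by [].
by rewrite expr0 mul1r sub0r oppr_ge0 lez_nat leqNgt b0 abszN.
Qed.

Lemma homog_comp D d (p : Q) : p \is d.-homog for weight ->
  pihomog weight D p = if d == D then p else 0.
Proof.
move=> pd; case: eqP => [<-|/eqP ne]; first exact: pihomog_dE.
exact: pihomog_ne0 ne pd.
Qed.

(** The generators are homogeneous for [weight], so the component of degree D only involves
    multiples of x_k y_k and products e_d z^f of weight exactly D. *)
Lemma graded_coinv (W : Q -> Prop) D : subspace W ->
  (forall k p, W ('X_(vr true k) * 'X_(vr false k) * p)) ->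
  (forall b d f, (0 < d)%N -> (wt f + wb m b * d)%N = D -> W (esum F m b d * zmon F f)) ->
  forall p, p \in ideal_gen coinv_rel -> W (pihomog weight D p).
Proof.
move=> WS Wxy We p /ideal_genP[s [sX ->]]; rewrite raddf_sum big_seq.
apply: (subspace_sum WS) => u /sX; move: u.2 => g {sX} gX.
rewrite [u.1]mpolyE mulr_suml raddf_sum; apply: (subspace_sum WS) => M _ /=.
rewrite -scalerAl linearZ /=; apply: (subspaceZ WS).
case: gX => [[k ->]|[b [d [d0 ->]]]].
  rewrite -mpolyXD -mpolyXD (@homog_comp D (weight (M + (U_(vr true k) + U_(vr false k)))%MM)).
    case: ifP => _; last exact: subspace0.
    by rewrite !mpolyXD mulrC; apply: Wxy.
  by rewrite dhomogX.
have [[k [q ->]]|[e ->]] := monomial_cases M.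
  have : forall h : Q, W (pihomog weight D ('X_(vr true k) * 'X_(vr false k) * h)).
    move=> h; rewrite [h]mpolyE mulr_sumr raddf_sum; apply: (subspace_sum WS) => N _ /=.
    rewrite -scalerAr linearZ /=; apply: (subspaceZ WS).
    rewrite -!mpolyXD (@homog_comp D (weight (U_(vr true k) + U_(vr false k) + N)%MM)).
      case: ifP => _; last exact: subspace0.
      by rewrite !mpolyXD; apply: Wxy.
    by rewrite dhomogX.
  move=> H; rewrite -(mulrA (_ * _) q); exact: H.
rewrite mulrC (@homog_comp D (wb m b * d + wt e)%N); last first.
  by apply: dhomogM; [apply: homog_esum|apply: homog_zmon].
by case: eqP => [E|_]; [apply: We; rewrite // addnC|apply: subspace0].
Qed.

Lemma subspace_all (W : Q -> Prop) : subspace W ->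
  (forall k p, W ('X_(vr true k) * 'X_(vr false k) * p)) ->
  (forall f, W (zmon F f)) -> forall p, W p.
Proof.
move=> WS Wxy Wz p; rewrite [p]mpolyE; apply: (subspace_sum WS) => M _.
by apply: (subspaceZ WS); have [[k [q ->]]|[e ->]] := monomial_cases M.
Qed.

(* Some None stands for c = ord_max and Some (Some t) for the break t; None only
   serves to complete the descent monomials to a family of (n+1)! elements. *)
Definition code_index : finType := ('S_n * option (option 'I_m))%type.

Definition index_pos (o : option (option 'I_m)) : 'I_n :=
  if o is Some o' then (if o' is Some t then lo t else ord_max) else ord0.

Definition is_descent (q : code_index) : bool :=
  if q.2 is Some o then (if o is Some t then t \in Des q.1 else true) else false.

Definition descent_code (q : code_index) : 'I_n -> int :=
  code (Des q.1) (index_pos q.2) \o q.1.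

Definition descent_mon (q : code_index) : Q := zmon F (descent_code q).

(** Outside the descents these are the products of [Wasc] and [Wstar]. *)
Definition completed_mon (q : code_index) : Q :=
  if is_descent q then descent_mon q else
  esum F m false (if q.2 is Some (Some t) then (m - t)%N else n) * descent_mon q.

Lemma descent_monE q :
  descent_mon q = poly_act q.1 (zmon F (code (Des q.1) (index_pos q.2))).
Proof. by rewrite poly_act_zmon. Qed.

Lemma admissible_index (w : 'S_n) c : admissible (Des w) c ->
  exists2 q : code_index, is_descent q & q.1 = w /\ index_pos q.2 = c.
Proof.
case=> [->|[t tD ->]]; first by exists (w, Some None).
by exists (w, Some (Some t)).
Qed.

(** If the coefficient of q0 were nonzero, the completed family without q0 would still span all
    functions on the (n+1)! points, although it has one member too few. *)
Lemma descent_mon_independent (a : code_index -> F) :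
  (forall q, ~~ is_descent q -> a q = 0) ->
  \sum_q a q *: descent_mon q \in ideal_gen coinv_rel -> forall q, a q = 0.
Proof.
move=> a0 aI q0; apply/eqP/negP => /negP nz.
have d0 : is_descent q0 by apply: contraNT nz => /a0 ->.
have /choice[rt rtP] := trunc_roots F.
pose ev (p : Q) : {ffun point_type m -> F^o} := [ffun x => p.@[point rt x]].
have evL c p p' : ev (c *: p + p') = c *: ev p + ev p'.
  by apply/ffunP=> x; rewrite !ffunE mevalD mevalZ.
pose X := [seq ev (completed_mon q) | q <- enum (predC1 q0)].
pose W p := ev p \in <<X>>%VS.
have WS : subspace W.
  split=> [|c p p' pW p'W].
    by rewrite /W (_ : ev 0 = 0) ?mem0v //; apply/ffunP=> x; rewrite !ffunE meval0.
  by rewrite /W evL; apply: memvD p'W; apply: memvZ.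
have Wpt p p' : (forall q, p.@[point rt q] = p'.@[point rt q]) -> W p -> W p'.
  by move=> E; rewrite /W (_ : ev p' = ev p) //; apply/ffunP=> x; rewrite !ffunE E.
have WX q : q != q0 -> W (completed_mon q).
  by move=> ne; apply: memv_span; apply: map_f; rewrite mem_enum.
have Wxy k p : W ('X_(vr true k) * 'X_(vr false k) * p).
  exact: (Wxy_point WS Wpt).
have Wz f : W (zmon F f).
  apply: (lower_bound_span rtP WS Wpt).
  - move=> D IH We w c /admissible_index[q qd [<- <-]] wtD; rewrite -descent_monE.
    have [E|ne] := eqVneq q q0; last by have := WX q ne; rewrite /completed_mon qd.
    (* The component of degree D of the relation expresses the missing monomial, modulo W, through
       other descent monomials of the same weight. *)
    rewrite E; apply: (subspace_scaleK WS nz).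
    have := graded_coinv WS Wxy We aI; rewrite raddf_sum (bigD1 q0) //= => H.
    have homD q' : pihomog weight D (a q' *: descent_mon q') =
        if wt (descent_code q') == D then a q' *: descent_mon q' else 0.
      rewrite linearZ /= (homog_comp _ (homog_zmon _)).
      by case: ifP; rewrite ?scaler0.
    move: H; rewrite homD (_ : wt (descent_code q0) == D) => [H|]; last first.
      by rewrite /descent_code wt_perm -E wtD.
    apply: (subspace_addK WS _ H).
    apply: (subspace_sum WS) => q' ne.
    rewrite homD; case: ifP => _; last exact: (subspace0 WS).
    have [qd'|/a0 ->] := boolP (is_descent q'); last by rewrite scale0r; apply: (subspace0 WS).
    by apply: (subspaceZ WS); have := WX q' ne; rewrite /completed_mon qd'.
  - move=> w t tD; pose q : code_index := (w, Some (Some t)).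
    have qd : is_descent q = false by rewrite /is_descent /= (negPf tD).
    have := WX q; rewrite /completed_mon qd descent_monE; apply.
    by apply: contraTneq d0 => <-; rewrite qd.
  - move=> w; pose q : code_index := (w, None).
    have := WX q; rewrite /completed_mon descent_monE; apply.
    by apply: contraTneq d0 => <-.
have Wall := subspace_all WS Wxy Wz.
have full : (fullv <= <<X>>)%VS.
  apply/subvP=> v _.
  have -> : v = \sum_x (v x : F) *: pure_tensor x (1 : F^o).
    apply/ffunP=> x; rewrite sum_ffunE (bigD1 x) //= big1 ?addr0.
      by rewrite !ffunE eqxx [_ *: _]mulr1.
    by move=> y yx; rewrite !ffunE eq_sym (negPf yx) scaler0.
  apply: memv_suml => x _; apply: memvZ.
  have [p pP] := interpolation (fun x y => @point_sep F m rt rtP x y) x.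
  suff <- : ev p = pure_tensor x (1 : F^o) by apply: Wall.
  by apply/ffunP=> y; rewrite !ffunE pP eq_sym; case: eqP.
have := leq_trans (dimvS full) (dim_span X); rewrite dimvf size_map -cardE.
rewrite (_ : dim _ = #|code_index|).
  have q0_in : (0 < #|code_index|)%N by apply/card_gt0P; exists q0.
  by rewrite cardC1 leqNgt prednK // leqnn.
by rewrite /dim /= muln1 /point_type /code_index !card_prod !card_option !card_ord.
Qed.

End DescentMonomials.

(** * Injectivity by counting *)

Section LinearAlgebra.
Variables (F : fieldType) (N B : lmodType F) (I : finType).

(** The count takes place in F^I: T sends a to the b-coordinates of a preimage of the combination of
    the e_p with coefficients a. Independence makes T injective, hence onto. A kernel vector of Phi
    thus has coordinates T c, and its image, the combination of the e_p with coefficients c,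
    vanishes, so c = 0. *)
Lemma injective_by_count (Phi : {linear N -> B}) (b : I -> N) (e : I -> B) :
  (forall x, exists a : I -> F, x = \sum_i a i *: b i) ->
  (forall a : I -> F, \sum_i a i *: e i = 0 -> forall i, a i = 0) ->
  (forall y, exists x, Phi x = y) -> injective Phi.
Proof.
move=> bspan eind surj; pose K := {ffun I -> F^o}.
have /choice[C CP] p : exists c : K, e p = \sum_i (c i : F) *: Phi (b i).
  have [x <-] := surj (e p); have [a ->] := bspan x.
  exists [ffun i => a i]; rewrite raddf_sum; apply: eq_bigr => i _.
  by rewrite /= linearZZ ffunE.
pose T (a : K) : K := \sum_p (a p : F) *: C p.
have Tlin : linear T.
  move=> c a1 a2; rewrite /T scaler_sumr -big_split; apply: eq_bigr => p _ /=.
  by rewrite !ffunE scalerDl scalerA.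
have TP a : \sum_i (T a i : F) *: Phi (b i) = \sum_p (a p : F) *: e p.
  under [RHS]eq_bigr => p _ do rewrite CP scaler_sumr.
  rewrite exchange_big; apply: eq_bigr => i _; rewrite sum_ffunE scaler_suml.
  by apply: eq_bigr => p _; rewrite ffunE scalerA.
pose L : 'End(K) := linfun (HB.pack_for {linear K -> K} T (GRing.isLinear.Build F K K *:%R T Tlin)).
have LE a : L a = T a by rewrite lfunE.
have ker0 : lker L == 0%VS.
  rewrite -subv0; apply/subvP=> a; rewrite memv_ker LE memv0 => /eqP Ta.
  apply/eqP/ffunP=> p; rewrite ffunE; apply: eind.
  by rewrite -TP Ta big1 // => i _; rewrite ffunE scale0r.
suff inj0 x : Phi x = 0 -> x = 0.
  by move=> x y xy; apply/eqP; rewrite -subr_eq0; apply/eqP/inj0; rewrite linearB /= xy subrr.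
have [a ->] := bspan x; rewrite raddf_sum => Phi0.
have : [ffun i => a i : F^o] \in limg L by rewrite lker0_limgf ?memvf.
case/memv_imgP=> c _; rewrite LE => aE.
have aT i : a i = T c i by rewrite -aE ffunE.
have c0 : c = 0.
  apply/ffunP=> p; rewrite ffunE; apply: eind; rewrite -TP -[RHS]Phi0.
  by apply: eq_bigr => i _; rewrite /= linearZZ -aT.
by rewrite big1 // => i _; rewrite aT c0 /T big1 ?ffunE ?scale0r // => p _; rewrite ffunE scale0r.
Qed.
End LinearAlgebra.

Lemma gmod_iso_inv (F : fieldType) (gT : finGroupType) (G : {group gT}) (M N : gmodule F G)
    (f : {linear N -> M}) :
  injective f -> (forall y, exists x, f x = y) ->
  {in G, forall g v, f (gact g v) = gact g (f v)} -> gmod_iso M N.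
Proof.
move=> finj fsurj fG; have /choice[h hP] := fsurj.
have fK : cancel f h by move=> x; apply: finj; rewrite hP.
have hlin : linear h by move=> a u v; apply: finj; rewrite linearP !hP.
exists (HB.pack_for {linear M -> N} h (GRing.isLinear.Build F M N *:%R h hlin)).
split; first by exists f.
by move=> g gG v; apply: finj; rewrite fG //= !hP.
Qed.

(** * The coinvariant algebra *)

Section Coinvariants.
Variables (F : numClosedFieldType) (m : nat).
Local Notation n := m.+1.
Local Notation Q := {mpoly F[n + n]}.
Local Notation B := (coinvariants F n).
Local Notation rel_ideal := (ideal_gen (@coinv_rel F m)).

Lemma rel_idealMr (u v : Q) : v \in rel_ideal -> u * v \in rel_ideal.
Proof. by move=> vI; rewrite -[_ * _]addr0; apply: ideal_gen_lin => //; apply: rpred0. Qed.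

Lemma rel_ideal_xy k (p : Q) : 'X_(vr true k) * 'X_(vr false k) * p \in rel_ideal.
Proof. by rewrite mulrC; apply/rel_idealMr/mem_ideal_gen; left; exists k. Qed.

Lemma rel_ideal_esum b d (p : Q) : (0 < d)%N -> esum F m b d * p \in rel_ideal.
Proof. by move=> d0; rewrite mulrC; apply/rel_idealMr/mem_ideal_gen; right; exists b, d. Qed.

Lemma rel_ideal_act w (p : Q) : p \in rel_ideal -> poly_act w p \in rel_ideal.
Proof.
apply: (ideal_gen_morph (f := msym (diag_perm w^-1%g))) => _ [[k ->]|[b [d [d0 ->]]]].
  left; exists (w^-1%g k); rewrite -!poly_act_var; exact: rmorphM.
by right; exists b, d; split=> //; apply: poly_act_esum.
Qed.

Lemma esum_eval0 b d : (0 < d)%N -> (esum F m b d).@[fun=> 0] = 0.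
Proof.
move=> d0; rewrite raddf_sum big1 //= => J /eqP Jd.
have [j jJ] : exists j, j \in J by apply/card_gt0P; rewrite Jd.
by rewrite rmorph_prod (bigD1 j) //= mevalXU mul0r.
Qed.

Lemma rel_ideal_eval0 (p : Q) : p \in rel_ideal -> p.@[fun=> 0] = 0.
Proof.
move=> /ideal_genP [s [sX ->]]; rewrite raddf_sum big_seq big1 //= => u us.
rewrite mevalM; have [[k ->]|[b [d [d0 ->]]]] := sX u us.
  by rewrite !mevalM !mevalXU !mulr0.
by rewrite esum_eval0 // mulr0.
Qed.

Lemma xy_ideal_sub (p : Q) : p \in @xy_ideal F n -> p \in rel_ideal.
Proof.
move=> /ideal_genP [s [sX ->]]; rewrite big_seq; apply: rpred_sum => u /sX [k ->].
by rewrite mulrC; apply: (rel_ideal_xy k).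
Qed.

(* Straightening z^e != 1 at a nonzero value shows that, modulo the ideal, every
   symmetrized polynomial is a constant. *)
Lemma symmetrize_const (p : Q) :
  exists c : F, \sum_(w : 'S_n) poly_act w p - c%:MP \in rel_ideal.
Proof.
pose W (p : Q) := exists c : F, \sum_(w : 'S_n) poly_act w p - c%:MP \in rel_ideal.
have symP c (p1 p2 : Q) : \sum_(w : 'S_n) poly_act w (c *: p1 + p2) =
    c *: (\sum_(w : 'S_n) poly_act w p1) + \sum_(w : 'S_n) poly_act w p2.
  rewrite scaler_sumr -big_split; apply: eq_bigr => w _; exact: poly_act_linear (in_setT w) _ _ _.
have WI (p' : Q) : p' \in rel_ideal -> W p'.
  move=> pI; exists 0; rewrite mpolyC0 subr0; apply: rpred_sum => w _; exact: rel_ideal_act.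
have WS : subspace W.
  split=> [|c p1 p2 [c1 h1] [c2 h2]]; first by apply: WI; apply: rpred0.
  exists (c * c1 + c2); rewrite symP mpolyCD mpolyCM mul_mpolyC opprD addrACA -scalerBr.
  by rewrite rpredD // ideal_genZ.
have Wxy k p' : W ('X_(vr true k) * 'X_(vr false k) * p') by apply/WI/rel_ideal_xy.
have We b d f : (0 < d)%N -> W (esum F m b d * zmon F f) by move=> d0; apply/WI/rel_ideal_esum.
apply: (subspace_all WS Wxy) => e; have [k] := ubnP (kappa e).
elim: k e => // k IH e ek.
have [e0|/existsP[i ei]] : (e =1 fun=> 0) \/ [exists i, e i != 0].
  have [ex|/existsPn H] := boolP [exists i, e i != 0]; [by right|left=> i].
  by apply/eqP; rewrite -[_ == _]negbK H.
  exists #|{: 'S_n}|%:R; rewrite (_ : zmon F e = 1).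
    rewrite (eq_bigr (fun=> 1)) => [|w _]; last exact: (rmorph1 (msym _)).
    by rewrite sumr_const mpolyC_nat subrr rpred0.
  by rewrite /zmon big1 // => i _; rewrite e0 expr0.
(* The nonzero exponent e i is at least 1 or at most -1, which makes this v eligible for
   [straighten]. *)
pose v : int := if 0 < e i then 1 else 0.
have cv : (1 <= v /\ exists i, v <= e i) \/ (v <= 0 /\ exists i, e i <= v - 1).
  by rewrite /v; case: ltP => H; [left|right]; split=> //; exists i; move: H ei; lia.
have [|c] := straighten WS Wxy (fun b d f d0 _ => We b d f d0) _ cv 1%g.
  by move=> f _ fk; apply: IH; lia.
rewrite poly_act1; set E := [set _ | _].
(* Symmetrization over the whole group absorbs the sum over the permutations of E. *)
have -> : \sum_w poly_act w (\sum_(h | perm_on E h) poly_act h (zmon F e)) =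
    #|[pred h : 'S_n | perm_on E h]|%:R *: \sum_w poly_act w (zmon F e).
  under eq_bigr => w _ do rewrite poly_act_sum.
  rewrite exchange_big /= scaler_nat -sumr_const; apply: eq_bigr => h _.
  rewrite [RHS](reindex_inj (mulIg h)) /=; apply: eq_bigr => w _.
  by rewrite poly_act_mulg.
set N := #|_|; have nz : N%:R != 0 :> F.
  by rewrite pnatr_eq0 -lt0n; apply/card_gt0P; exists 1%g; apply: perm_on1.
move=> H; exists (N%:R^-1 * c).
have -> : (N%:R^-1 * c)%:MP = N%:R^-1 *: (c%:MP : Q) by rewrite mpolyCM mul_mpolyC.
rewrite -[X in X - _](scalerK nz) -scalerBr; exact: ideal_genZ.
Qed.

Definition coinv_pi (p : Q) : B := lpi (@coinv_idealZ F n) (tpi p).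

Lemma coinv_pi_linear : linear coinv_pi.
Proof. by move=> a p q; rewrite /coinv_pi !linearP. Qed.
HB.instance Definition _ := GRing.isLinear.Build F Q B *:%R coinv_pi coinv_pi_linear.

Lemma coinv_pi_surj b : exists p, coinv_pi p = b.
Proof. by exists (repr (repr b : tensA F n)); rewrite /coinv_pi tpiK lpiK. Qed.

Lemma coinv_pi_act w p : coinv_pi (poly_act w p) = gact w (coinv_pi p).
Proof.
rewrite /coinv_pi -tensA_act_pi.
exact/esym/(gquot_act_pi (M := tensA_gmod F n) (@coinv_idealZ F n) (@coinv_ideal_stable F n) _ (in_setT w)).
Qed.

(** Let g represent an invariant P vanishing at 0. Modulo the relations n! g is the symmetrization
    of g, a constant by [symmetrize_const], and evaluation at 0 shows that this constant is 0.
    Conversely the e_d are themselves invariants vanishing at 0. *)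
Lemma coinv_pi_eq0 p : coinv_pi p = 0 <-> p \in rel_ideal.
Proof.
have piE : coinv_pi p = 0 <-> tpi p \in @coinv_ideal F n.
  rewrite -[0](linear0 (lpi (@coinv_idealZ F n))) /coinv_pi; split=> [/eqP|H]; rewrite ?lpi_eq ?subr0 //.
  by apply/eqP; rewrite lpi_eq subr0.
have tpi_xy (q : Q) : q \in @xy_ideal F n -> tpi q = 0.
  by move=> qI; apply/eqP; rewrite -(linear0 (@tpi F n)) tpi_eq subr0.
rewrite piE; split=> [/ideal_genP [s [sX tE]]|/ideal_genP [s [sX ->]]]; last first.
  rewrite raddf_sum big_seq; apply: rpred_sum => u us /=; rewrite rmorphM.
  rewrite -[_ * _]addr0; apply: ideal_gen_lin; last exact: ideal_gen0.
  have [[k ->]|[b [d [d0 ->]]]] := sX u us.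
    rewrite -[X in X \in _]/(tpi _) tpi_xy; first exact: ideal_gen0.
    by apply: mem_ideal_gen; exists k.
  apply: mem_ideal_gen; split=> [w|]; first by rewrite tensA_act_pi poly_act_esum.
  by rewrite tensA_eval0_pi esum_eval0.
have rep P : pos_invariant P -> repr (P : tensA F n) \in rel_ideal.
  move=> [Pinv P0]; set g := repr P; have gE : tpi g = P by apply: tpiK.
  have [c cI] := symmetrize_const g.
  have H : \sum_(w : 'S_n) poly_act w g - #|{: 'S_n}|%:R *: g \in rel_ideal.
    apply: xy_ideal_sub; rewrite -tpi_eq linearZ raddf_sum /=; apply/eqP.
    rewrite (eq_bigr (fun=> P)) => [|w _]; last by rewrite -tensA_act_pi gE Pinv.
    by rewrite sumr_const gE scaler_nat.
  have {cI H} H : #|{: 'S_n}|%:R *: g - c%:MP \in rel_ideal.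
    by rewrite -[X in X - _](subKr (\sum_(w : 'S_n) poly_act w g)) addrAC rpredB.
  have := rel_ideal_eval0 H; rewrite mevalB mevalZ mevalC.
  have -> : g.@[fun=> 0] = 0 by move: P0; rewrite /tensA_eval0.
  rewrite mulr0 sub0r => /eqP; rewrite oppr_eq0 => /eqP c0.
  have nz : #|{: 'S_n}|%:R != 0 :> F.
    by rewrite pnatr_eq0 -lt0n; apply/card_gt0P; exists 1%g.
  rewrite -[g](scalerK nz); apply: ideal_genZ.
  by move: H; rewrite c0 mpolyC0 subr0.
have : p - \sum_(u <- s) repr u.1 * repr u.2 \in rel_ideal.
  apply: xy_ideal_sub; rewrite -tpi_eq tE raddf_sum /=; apply/eqP.
  by apply: eq_bigr => u _; rewrite rmorphM /= !tpiK.
move=> H; rewrite -(subrK (\sum_(u <- s) repr u.1 * repr u.2) p); apply: rpredD => //.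
by rewrite big_seq; apply: rpred_sum => u /sX uP; apply/rel_idealMr/rep.
Qed.

Lemma coinv_pi_conv (f : {ffun 'S_n -> F^o}) p :
  coinv_pi (conv (M := poly_gmod F n) f p) = conv f (coinv_pi p).
Proof.
rewrite /conv raddf_sum; apply: eq_bigr => w _ /=.
by rewrite linearZ /= coinv_pi_act.
Qed.
End Coinvariants.

(** * Generators of the coinvariant algebra *)

Section Generators.
Variables (F : numClosedFieldType) (m : nat).
Local Notation n := m.+1.
Local Notation Q := {mpoly F[n + n]}.
Local Notation B := (coinvariants F n).

(** u collects the codes without y-breaks and v_t those with first y-break t; multiplication by
    eps_T recovers each summand. As 1 + [adj t] is invariant under [young (~: [set t])], it
    annihilates eps_T for every T containing t, so [adj t] negates v_t. *)
Lemma coinv_generators : exists (u : B) (v : 'I_m -> B),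
  (forall t, gact (adj t) (v t) = - v t) /\
  forall W : B -> Prop, subspace W -> (forall w b, W b -> W (gact w b)) ->
    W u -> (forall t, W (v t)) -> forall b, W b.
Proof.
have [eps [eps1 epsY epsO eps0]] := descent_idempotents F m.
pose z T c : B := coinv_pi (zmon F (code T c)).
pose u : B := \sum_T conv (eps T) (z T ord_max).
pose v t : B := \sum_(T : {set 'I_m} | t \in T) conv (eps T) (z T (lo t)).
exists u, v; split=> [t|W WS Wact Wu Wv b].
  pose Y : {ffun 'S_n -> F^o} := [ffun w => (w \in young (~: [set t]))%:R].
  have : conv Y (v t) = 0.
    rewrite conv_sumr big1 // => T tT; rewrite -convA (eps0 (~: [set t])) ?conv0l //.
      by move=> w k kY; rewrite !ffunE groupMr.
    by apply/negP=> /subsetP/(_ t tT); rewrite !inE eqxx.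
  rewrite conv_indicator young_one_break big_setU1 ?big_set1; last first.
    rewrite inE; apply/eqP=> /(congr1 (fun s : 'S_n => s (lo t))).
    by rewrite perm1 /adj tpermL => /eqP; rewrite (negPf (lo_neq_hi t)).
  by rewrite gact1 => H; apply/eqP; rewrite -addr_eq0 addrC; apply/eqP.
have Wconv f c : W c -> W (conv f c).
  by move=> Wc; apply: (subspace_sum WS) => w _; apply: (subspaceZ WS); apply: (Wact).
have [p <-] := coinv_pi_surj b; pose W' (p : Q) := W (coinv_pi p).
have W'S : subspace W'.
  split=> [|a p1 p2 W1 W2]; first by rewrite /W' linear0; apply: subspace0.
  by rewrite /W' linearP; apply: WS.2.
have W'I (q : Q) : q \in ideal_gen (@coinv_rel F m) -> W' q.
  by move=> /coinv_pi_eq0 q0; rewrite /W' q0; apply: subspace0.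
have W'xy k (q : Q) : W' ('X_(vr true k) * 'X_(vr false k) * q) by apply/W'I/rel_ideal_xy.
apply: (subspace_all W'S W'xy).
apply: (equivariant_span (W := W') W'S _ W'xy _ eps1 epsY eps0).
- by move=> w q; rewrite /W' coinv_pi_act; apply: Wact.
- by move=> c d f d0; apply/W'I/rel_ideal_esum.
move=> T c Tc; rewrite /W' coinv_pi_conv -/(z T c).
case: Tc => [->|[t tT ->]].
  have -> : conv (eps T) (z T ord_max) = conv (eps T) u; last exact: Wconv.
  rewrite conv_sumr (bigD1 T) //= -convA epsO eqxx big1 ?addr0 // => T' ne.
  by rewrite -convA epsO eq_sym (negPf ne) conv0l.
have -> : conv (eps T) (z T (lo t)) = conv (eps T) (v t); last exact: Wconv.
rewrite conv_sumr (bigD1 T) //= -convA epsO eqxx big1 ?addr0 // => T' /andP[_ ne].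
by rewrite -convA epsO eq_sym (negPf ne) conv0l.
Qed.
End Generators.

(** * The decomposition *)

Section InducedSign.
Variables (F : numClosedFieldType) (n : nat) (i j : 'I_n).
Hypothesis neq_ij : i != j.
Local Notation L := (sign_gmod F (Sym_group [set i; j])).
Variable M : gmodule F [set: 'S_n]%G.

Lemma Sym_pair (h : 'S_n) : h \in Sym_group [set i; j] -> h = 1%g \/ h = tperm i j.
Proof.
rewrite inE => hij.
have hi : h i \in [set i; j] by rewrite (perm_closed _ hij) !inE eqxx.
have hj : h j \in [set i; j] by rewrite (perm_closed _ hij) !inE eqxx orbT.
have ne : h i != h j by apply: contra neq_ij => /eqP/perm_inj->.
have out k : k != i -> k != j -> h k = k.
  by move=> ki kj; apply: (out_perm hij); rewrite !inE negb_or ki.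
move: hi hj ne; rewrite !inE => /orP[]/eqP hi /orP[]/eqP hj; rewrite hi hj ?eqxx // => _.
  left; apply/permP=> k; rewrite perm1.
  by have [->|ki] := eqVneq k i => //; have [->|kj] := eqVneq k j => //; apply: out.
right; apply/permP=> k; case: tpermP => [->|->|/eqP ki /eqP kj] //; exact: out.
Qed.

Section Lift.
Variable v : M.
Hypothesis v_anti : gact (tperm i j) v = - v.

(** In a relation with h the transposition of i and j the two terms cancel, because h acts by -1
    both on v and on the sign module. *)
Lemma conv_balanced (f : {ffun 'S_n -> F^o}) :
  f \in span_of (@balanced F _ _ L) -> conv f v = 0.
Proof.
move=> /span_ofP [s [sX ->]]; rewrite big_seq conv_suml big1 // => x /sX.
move=> [g [h [l [hH ->]]]]; rewrite convZl.
have pureE k (a : F) : conv (pure_tensor k (a : F^o)) v = a *: gact k v.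
  rewrite -conv_pure -convZl; congr conv; apply/ffunP=> y; rewrite !ffunE.
  by case: ifP; rewrite ?scaler0 // [_ *: _]mulr1.
have -> : conv (pure_tensor (g * h)%g l - pure_tensor g (gact h l) : {ffun 'S_n -> F^o}) v =
    conv (pure_tensor (g * h)%g l : {ffun 'S_n -> F^o}) v -
    conv (pure_tensor g (gact h l) : {ffun 'S_n -> F^o}) v.
  exact: convBl.
rewrite !pureE gact_mulg /= /sign_act; case: (Sym_pair hH) => ->.
  by rewrite gact1 odd_perm1 scale1r subrr scaler0.
rewrite v_anti odd_tperm neq_ij expr1 scaleN1r scaleNr -[- v]scaleN1r gactZ.
by rewrite scaleN1r scalerN subrr scaler0.
Qed.

(** Frobenius reciprocity: the tensor of g and l goes to l g v, computed on a representative. *)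
Definition ind_lift (x : induced L) : M := conv (repr x : {ffun 'S_n -> F^o}) v.

Definition ind_pi (f : {ffun 'S_n -> F^o}) : induced L :=
  lpi (@span_ofZ _ _ (@balanced F _ _ L)) f.

Lemma ind_liftE f : ind_lift (ind_pi f) = conv f v.
Proof.
apply/eqP; rewrite -subr_eq0 /ind_lift.
rewrite -convBl; exact/eqP/conv_balanced/lpi_repr.
Qed.

Lemma ind_piP (x : induced L) : exists f, x = ind_pi f.
Proof. by exists (repr x); rewrite /ind_pi lpiK. Qed.

Lemma ind_pi_linear : linear ind_pi.
Proof. by move=> a f g; rewrite /ind_pi linearP. Qed.

Lemma ind_pi_act w f : ind_pi (ltrans w f) = gact w (ind_pi f).
Proof.
exact/esym/(gquot_act_pi (M := free_gmod 'S_n L) (@span_ofZ _ _ _)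
  (@balanced_stable F _ _ L) f (in_setT w)).
Qed.

Lemma ind_lift_linear : linear ind_lift.
Proof.
move=> a x y; have [f ->] := ind_piP x; have [g ->] := ind_piP y.
by rewrite -ind_pi_linear !ind_liftE conv_linearl.
Qed.

Lemma ind_lift0 : ind_lift 0 = 0.
Proof.
apply: (addrI (ind_lift 0)); have := ind_lift_linear 1 0 0.
by rewrite !scale1r !addr0 => <-.
Qed.

Lemma ind_lift_act w x : ind_lift (gact w x) = gact w (ind_lift x).
Proof.
by have [f ->] := ind_piP x; rewrite -ind_pi_act !ind_liftE conv_ltrans.
Qed.
End Lift.

Lemma ind_pi_swap g :
  ind_pi (pure_tensor (g * tperm i j)%g (1 : F^o)) = - ind_pi (pure_tensor g (1 : F^o)).
Proof.
have -> : - ind_pi (pure_tensor g (1 : F^o)) = ind_pi (pure_tensor g (-1 : F^o)).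
  have p0 : ind_pi 0 = 0.
    by apply: (addrI (ind_pi 0)); have := ind_pi_linear 1 0 0; rewrite !scale1r !addr0 => <-.
  rewrite -scaleN1r -[LHS]addr0 -{1}p0 -ind_pi_linear; congr ind_pi.
  apply/ffunP=> x; rewrite !ffunE addr0; case: ifP => _; last by rewrite scaler0.
  by rewrite [_ *: _]mulr1.
apply/eqP; rewrite lpi_eq; apply: mem_span_of.
exists g, (tperm i j), (1 : F^o); split.
  by rewrite inE; apply/subsetP=> x; rewrite !inE; case: tpermP => [->|->|]; rewrite ?eqxx ?orbT.
by rewrite /= /sign_act odd_tperm neq_ij expr1 scaleN1r.
Qed.
End InducedSign.

Lemma Des_adj (m : nat) (w : 'S_m.+1) (t : 'I_m) : (t \in Des (w * adj t)%g) = (t \notin Des w).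
Proof.
rewrite !inE invMg !permM /adj tpermV tpermL tpermR -leqNgt ltn_neqAle.
rewrite andb_idl // => _; apply/eqP=> /val_inj/perm_inj/eqP.
by rewrite (negPf (lo_neq_hi t)).
Qed.

Lemma subspace_pure (F : fieldType) (gT : finGroupType) (W : {ffun gT -> F^o} -> Prop) :
  subspace W -> (forall g, W (pure_tensor g (1 : F^o))) -> forall f, W f.
Proof.
move=> WS Wp f.
have -> : f = \sum_x (f x : F) *: pure_tensor x (1 : F^o).
  apply/ffunP=> x; rewrite sum_ffunE (bigD1 x) //= big1 ?addr0.
    by rewrite !ffunE eqxx [_ *: _]mulr1.
  by move=> y yx; rewrite !ffunE eq_sym (negPf yx) scaler0.
by apply: (subspace_sum WS) => x _; apply: (subspaceZ WS).
Qed.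

Section Combinations.
Variables (F : fieldType) (V V' : lmodType F) (I : finType) (b : I -> V).

Definition combination (x : V) := exists a : I -> F, x = \sum_i a i *: b i.

Lemma combination_subspace : subspace combination.
Proof.
split=> [|c x1 x2 [a1 ->] [a2 ->]].
  by exists (fun=> 0); rewrite big1 // => q _; rewrite scale0r.
exists (fun q => c * a1 q + a2 q); rewrite scaler_sumr -big_split.
by apply: eq_bigr => q _; rewrite scalerDl scalerA.
Qed.

Lemma combination_mem i : combination (b i).
Proof.
exists (fun p => (p == i)%:R); rewrite (bigD1 i) //= eqxx scale1r big1 ?addr0 // => p /negPf->.
by rewrite scale0r.
Qed.

Lemma pair0r_linear : linear (fun x : V => (x, 0) : V * V').
Proof. by move=> a x y; apply: injective_projections; rewrite /= ?scaler0 ?addr0. Qed.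

Lemma pair0l_linear : linear (fun x : V' => (0, x) : V * V').
Proof. by move=> a x y; apply: injective_projections; rewrite /= ?scaler0 ?addr0. Qed.

Lemma pair_split (x : V) (y : V') : (x, y) = (x, 0) + (0, y).
Proof. by apply: injective_projections; rewrite /= ?addr0 ?add0r. Qed.
End Combinations.

Lemma subspace_comp (F : fieldType) (V V' : lmodType F) (W : V' -> Prop) (f : V -> V') :
  subspace W -> linear f -> subspace (fun x => W (f x)).
Proof.
move=> WS fl; split=> [|a x y Wx Wy]; last by rewrite fl; apply: WS.2.
have -> : f 0 = 0; last exact: (subspace0 WS).
by apply: (addrI (f 0)); have := fl 1 0 0; rewrite !scale1r !addr0 => <-.
Qed.

Lemma subspace_ffun (F : fieldType) (V : lmodType F) (I : finType)
    (W : {ffun I -> V} -> Prop) : subspace W ->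
  (forall t y, W [ffun s => if s == t then y else 0]) -> forall g, W g.
Proof.
move=> WS Wt g; have -> : g = \sum_t [ffun s => if s == t then g t else 0].
  apply/ffunP=> s; rewrite sum_ffunE (bigD1 s) //= ffunE eqxx big1 ?addr0 // => t /negPf ts.
  by rewrite ffunE eq_sym ts.
by apply: (subspace_sum WS).
Qed.

Section Decomposition.
Variables (F : numClosedFieldType) (m : nat) (i j : 'I_m.+1).
(** An element of ['I_m] exists exactly when n >= 2, that is when a copy of the induced module is
    present. *)
Hypothesis neq_ij : 'I_m -> i != j.
Local Notation n := m.+1.
Local Notation B := (coinvariants F n).
Local Notation L := (sign_gmod F (Sym_group [set i; j])).
Local Notation N := (gsum (regular_gmod F 'S_n) (gcopies m (induced L))).

Definition single (t : 'I_m) (y : induced L) : {ffun 'I_m -> induced L} :=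
  [ffun s => if s == t then y else 0].

Lemma single_linear t : linear (single t).
Proof.
move=> a x y; apply/ffunP=> s; rewrite !ffunE; case: ifP => // _.
by rewrite scaler0 addr0.
Qed.

(** It conjugates the transposition of i and j into [adj t], so that all copies are induced from one
    subgroup. *)
Definition carry (t : 'I_m) : 'S_n :=
  (tperm i (lo t) * tperm (tperm i (lo t) j) (hi t))%g.

Lemma carryP t : carry t i = lo t /\ carry t j = hi t.
Proof.
rewrite /carry !permM tpermL; split; last by rewrite tpermL.
have ne1 : tperm i (lo t) j != lo t.
  by rewrite -[X in _ != X](tpermL i (lo t)) (inj_eq perm_inj) eq_sym; apply: neq_ij.
by apply: tpermD => //; rewrite eq_sym lo_neq_hi.
Qed.

Lemma tperm_carry t : (tperm i j * carry t = carry t * adj t)%g.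
Proof. by rewrite conjgC tpermJ; have [-> ->] := carryP t. Qed.

Section Map.
Variables (M : gmodule F [set: 'S_n]%G) (u : M) (v : 'I_m -> M).
Hypothesis v_anti : forall t, gact (adj t) (v t) = - v t.

Definition carried t : M := gact (carry t) (v t).

Lemma carried_anti t : gact (tperm i j) (carried t) = - carried t.
Proof.
rewrite /carried -gact_mulg tperm_carry gact_mulg v_anti -scaleN1r gactZ.
by rewrite scaleN1r.
Qed.

Definition decomp_map (x : N) : M :=
  conv (x.1 : {ffun 'S_n -> F^o}) u +
  \sum_t ind_lift (carried t) ((x.2 : {ffun 'I_m -> induced L}) t).

Lemma decomp_map_linear : linear decomp_map.
Proof.
move=> a x y; rewrite /decomp_map /= conv_linearl scalerDr addrACA; congr (_ + _).
rewrite scaler_sumr -big_split; apply: eq_bigr => t _ /=.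
by rewrite !ffunE (ind_lift_linear (neq_ij t) (carried_anti t)).
Qed.
HB.instance Definition _ := GRing.isLinear.Build F N M *:%R decomp_map decomp_map_linear.

Lemma decomp_map_act w x : decomp_map (gact w x) = gact w (decomp_map x).
Proof.
rewrite /decomp_map gactD; congr (_ + _); first exact: conv_ltrans.
rewrite gact_sum; apply: eq_bigr => t _; rewrite -(ind_lift_act (neq_ij t) (carried_anti t)).
by congr ind_lift; apply: ffunE.
Qed.

Lemma decomp_map_surj :
  (forall W : M -> Prop, subspace W -> (forall w b, W b -> W (gact w b)) ->
    W u -> (forall t, W (v t)) -> forall b, W b) ->
  forall b, exists x, decomp_map x = b.
Proof.
move=> gen; have Wact w b : (exists x, decomp_map x = b) -> exists x, decomp_map x = gact w b.
  by move=> [x <-]; exists (gact w x); apply: decomp_map_act.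
have lift0 t := ind_lift0 (neq_ij t) (carried_anti t).
apply: gen => //.
- split=> [|a b1 b2 [x1 <-] [x2 <-]]; first by exists 0; apply: linear0.
  by exists (a *: x1 + x2); apply: decomp_map_linear.
- exists ((pure_tensor 1%g (1 : F^o) : {ffun 'S_n -> F^o}), 0).
  by rewrite /decomp_map /= conv_pure gact1 big1 ?addr0 // => t _; rewrite ffunE lift0.
move=> t; suff /(Wact (carry t)^-1%g) : exists x, decomp_map x = carried t.
  by rewrite /carried -gact_mulg mulVg gact1.
exists (0, single t (ind_pi i j (pure_tensor 1%g (1 : F^o)))).
rewrite /decomp_map /= conv0l add0r (bigD1 t) //= ffunE eqxx big1 ?addr0.
  by rewrite (ind_liftE (neq_ij t) (carried_anti t)) conv_pure gact1.
by move=> s /negPf st; rewrite ffunE st lift0.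
Qed.

(** With w = [q.1], [decomp_map] sends these vectors to w u and w v_t. *)
Definition basis_vector (q : code_index m) : N :=
  match q.2 with
  | Some None => ((pure_tensor q.1 (1 : F^o) : {ffun 'S_n -> F^o}), 0)
  | Some (Some t) => (0, single t (ind_pi i j (pure_tensor (q.1 * (carry t)^-1)%g (1 : F^o))))
  | None => 0
  end.

(** In copy t, the tensors of g and of g * [tperm i j] with 1 are opposite, and exactly one of g *
    [carry t] and g * [carry t] * [adj t] has a descent at t. Half of the tensors therefore
    suffice. *)
Lemma basis_vector_span (x : N) :
  combination (fun q : {q in @is_descent m} => basis_vector (val q)) x.
Proof.
set W := combination _; have WS : subspace W by apply: combination_subspace.
have Wb q : is_descent q -> W (basis_vector q).
  by move=> qd; apply: (combination_mem _ (exist _ q qd)).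
have W1 (f : {ffun 'S_n -> F^o}) : W (f, 0).
  by apply: (subspace_pure (subspace_comp WS (@pair0r_linear _ _ _))) => w; apply: (Wb (w, Some None)).
have W2S : subspace (fun y => W (0, y)) by apply: (subspace_comp WS (@pair0l_linear _ _ _)).
have W2 t y : W (0, single t y).
  have [f ->] := ind_piP y.
  apply: (subspace_pure (subspace_comp (subspace_comp W2S (@single_linear t)) (@ind_pi_linear F _ i j))).
  move=> g; have [tD|tD] := boolP (t \in Des (g * carry t)%g).
    by have := Wb ((g * carry t)%g, Some (Some t)) tD; rewrite /basis_vector /= mulgK.
  have := Wb ((g * carry t * adj t)%g, Some (Some t)).
  rewrite /basis_vector /= -(mulgA g) -tperm_carry mulgA mulgK -mulgA tperm_carry mulgA.
  rewrite /is_descent /= Des_adj => /(_ tD).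
  rewrite ind_pi_swap ?neq_ij // => H.
  have := subspaceN W2S H; congr W; congr (_, _); apply/ffunP=> s; rewrite !ffunE.
  by case: ifP => _; rewrite ?oppr0 ?opprK.
case: x => f g; rewrite pair_split; apply: (subspaceD WS) => //.
exact: (subspace_ffun W2S).
Qed.
End Map.

(** [decomp_map] is onto by [coinv_generators]. Its source is spanned by vectors indexed like the
    descent monomials, which are independent in its target, so the kernel is 0. *)
Lemma coinvariants_iso : gmod_iso B N.
Proof.
have [u [v [v_anti gen]]] := coinv_generators F m.
apply: (@gmod_iso_inv _ _ _ _ _ (decomp_map u v)).
- apply: (@injective_by_count _ _ _ {q in @is_descent m} _
    (fun q => basis_vector (val q)) (fun q => coinv_pi (descent_mon F (val q)))).
  + exact: basis_vector_span.
  + move=> a sum0 q.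
    pose a' (q : code_index m) : F := if insub q is Some q' then a q' else 0.
    have a'E (p : {q in @is_descent m}) : a' (val p) = a p by rewrite /a' valK.
    rewrite -a'E; apply: (@descent_mon_independent F m a').
      by move=> p np; rewrite /a' insubN.
    apply/coinv_pi_eq0; rewrite -[RHS]sum0 raddf_sum (bigID (fun q => q \in @is_descent m)) /=.
    rewrite [X in _ + X]big1 ?addr0 => [|p np]; last by rewrite /a' insubN // scale0r linear0.
    by rewrite big_sub; apply: eq_bigr => p _; rewrite a'E linearZ.
  + exact: decomp_map_surj.
- exact: decomp_map_surj.
- by move=> w _ x; apply: decomp_map_act.
Qed.
End Decomposition.

Theorem theorem1 (R : realType) (n : nat) (n_ge1 : (1 <= n)%N)
    (i j : 'I_n) (neq_ij : (2 <= n)%N -> i != j) :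
  gmod_iso (coinvariants R[i] n)
    (gsum (regular_gmod R[i] 'S_n)
       (gcopies (n - 1)
          (induced (sign_gmod R[i] (Sym_group [set i; j]))))).
Proof.
case: n n_ge1 i j neq_ij => // m _ i j neq_ij; rewrite subn1 /=.
by apply: coinvariants_iso => t; apply: neq_ij; rewrite ltnS (leq_ltn_trans _ (ltn_ord t)).
Qed.
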